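(* Let $k$ be an algebraically closed field and $\mathcal{P}$ a $k$-linear category with split idempotents such that $\mathrm{mod}\,\mathcal{P}$ is a Frobenius category. Let $S$ be an auto-equivalence of $\mathcal{P}$, and denote also by $S$ its extension to an exact functor $\mathrm{mod}\,\mathcal{P}\to\mathrm{mod}\,\mathcal{P}$. Assume there exists an exact sequence of exact functors from $\mathrm{mod}\,\mathcal{P}$ to $\mathrm{mod}\,\mathcal{P}$ $$0\to \mathrm{Id}\to X^0\to X^1\to X^2\to S\to 0,$$ where the $X^i$, $i=0,1,2$, take values in $\mathrm{proj}\,\mathcal{P}$. Then the category $\mathcal{P}$ has a structure of triangulated category with suspension functor $S$.
   Context: $\mathrm{mod}\,\mathcal{P}$ is the (exact) category of finitely presented contravariant functors from $\mathcal{P}$ to the category $\mathrm{mod}\,k$ of finite-dimensional vector spaces; since idempotents split in $\mathcal{P}$, the projective objects of $\mathrm{mod}\,\mathcal{P}$ are the representable functors, and $\mathrm{proj}\,\mathcal{P}$ denotes the full subcategory of these, identified with $\mathcal{P}$ by the Yoneda functor. A Frobenius category is an exact category with enough projectives and enough injectives in which projectives and injectives coincide. A sequence of functors is exact if it is exact when evaluated at each object. *)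

(* Defs.v *)
(* boolp provides functional extensionality and proof irrelevance, so that
   natural transformations are compared by Leibniz equality. *)
From HB Require Import structures.
From mathcomp Require Import all_boot all_algebra.
From mathcomp Require Import boolp.

Set Implicit Arguments.
Unset Strict Implicit.
Unset Printing Implicit Defensive.

Import GRing.Theory.
Local Open Scope ring_scope.

Declare Scope cat_scope.
Delimit Scope cat_scope with cat.
Local Open Scope cat_scope.

Record precat := Precat {
  ob :> Type;
  Hom : ob -> ob -> zmodType;
  idm : forall A, Hom A A;
  cmp : forall A B C, Hom B C -> Hom A B -> Hom A C;
  cmp1m : forall A B (f : Hom A B), cmp (idm B) f = f;
  cmpm1 : forall A B (f : Hom A B), cmp f (idm A) = f;
  cmpA : forall A B C D (h : Hom C D) (g : Hom B C) (f : Hom A B),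
    cmp h (cmp g f) = cmp (cmp h g) f;
  cmpDl : forall A B C (g g' : Hom B C) (f : Hom A B),
    cmp (g + g') f = cmp g f + cmp g' f;
  cmpDr : forall A B C (g : Hom B C) (f f' : Hom A B),
    cmp g (f + f') = cmp g f + cmp g f' }.

Arguments Hom {p} _ _.
Arguments idm {p} _.
Arguments cmp {p A B C} _ _.

Notation "g ∘ f" := (cmp g f) (at level 40, left associativity) : cat_scope.

Record functor (C D : precat) := Functor {
  fob :> C -> D;
  fmap : forall A B, Hom A B -> Hom (fob A) (fob B);
  fmap1 : forall A, fmap (idm A) = idm (fob A);
  fmapM : forall A B E (g : Hom B E) (f : Hom A B),
    fmap (g ∘ f) = fmap g ∘ fmap f;
  fmapD : forall A B (f g : Hom A B), fmap (f + g) = fmap f + fmap g }.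

Arguments fmap {C D} _ {A B} _.

Definition idF (C : precat) : functor C C :=
  @Functor C C id (fun _ _ => id) (fun _ => erefl)
    (fun _ _ _ _ _ => erefl) (fun _ _ _ _ => erefl).

Section CompF.
Variables (C D E : precat) (G : functor D E) (F : functor C D).

Fact compF1 A : fmap G (fmap F (idm A)) = idm (G (F A)).
Proof. by rewrite !fmap1. Qed.

Fact compFM A B X (g : Hom B X) (f : Hom A B) :
  fmap G (fmap F (g ∘ f)) = fmap G (fmap F g) ∘ fmap G (fmap F f).
Proof. by rewrite !fmapM. Qed.

Fact compFD A B (f g : Hom A B) :
  fmap G (fmap F (f + g)) = fmap G (fmap F f) + fmap G (fmap F g).
Proof. by rewrite !fmapD. Qed.

Definition compF : functor C E :=
  @Functor C E (fun A => G (F A)) (fun _ _ f => fmap G (fmap F f))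
    compF1 compFM compFD.
End CompF.

Record nattrans (C D : precat) (F G : functor C D) := Nattrans {
  ntc :> forall A, Hom (F A) (G A);
  ntcP : forall A B (f : Hom A B), ntc B ∘ fmap F f = fmap G f ∘ ntc A }.

Definition is_iso (C : precat) (A B : C) (f : Hom A B) : Prop :=
  exists g : Hom B A, g ∘ f = idm A /\ f ∘ g = idm B.

Definition isomorphic (C : precat) (A B : C) : Prop :=
  exists f : Hom A B, is_iso f.

Definition nat_isomorphic (C D : precat) (F G : functor C D) : Prop :=
  exists t : nattrans F G, forall A, is_iso (t A).

Definition is_autoequivalence (C : precat) (S : functor C C) : Prop :=
  exists T : functor C C,
    nat_isomorphic (compF S T) (idF C) /\ nat_isomorphic (compF T S) (idF C).

Definition is_zero (C : precat) (Z : C) : Prop := idm Z = 0.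

Definition is_biproduct (C : precat) (A B X : C) (i1 : Hom A X)
    (i2 : Hom B X) (p1 : Hom X A) (p2 : Hom X B) : Prop :=
  [/\ p1 ∘ i1 = idm A, p2 ∘ i2 = idm B, p1 ∘ i2 = 0, p2 ∘ i1 = 0
    & i1 ∘ p1 + i2 ∘ p2 = idm X].

Definition is_additive (C : precat) : Prop :=
  (exists Z : C, is_zero Z) /\
  (forall A B : C, exists (X : C) (i1 : Hom A X) (i2 : Hom B X)
     (p1 : Hom X A) (p2 : Hom X B), is_biproduct i1 i2 p1 p2).

Definition split_idempotents (C : precat) : Prop :=
  forall (A : C) (e : Hom A A), e ∘ e = e ->
  exists (B : C) (r : Hom A B) (s : Hom B A), s ∘ r = e /\ r ∘ s = idm B.

Section Exact.
Variable C : precat.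

Definition is_kernel (A B D : C) (i : Hom A B) (p : Hom B D) : Prop :=
  p ∘ i = 0 /\
  forall (X : C) (x : Hom X B), p ∘ x = 0 -> exists! y : Hom X A, i ∘ y = x.

Definition is_cokernel (A B D : C) (i : Hom A B) (p : Hom B D) : Prop :=
  p ∘ i = 0 /\
  forall (X : C) (x : Hom B X), x ∘ i = 0 -> exists! y : Hom D X, y ∘ p = x.

Definition is_pushout (A B A' B' : C) (i : Hom A B) (a : Hom A A')
    (b : Hom B B') (i' : Hom A' B') : Prop :=
  b ∘ i = i' ∘ a /\
  forall (X : C) (x : Hom B X) (y : Hom A' X), x ∘ i = y ∘ a ->
    exists! z : Hom B' X, z ∘ b = x /\ z ∘ i' = y.

Definition is_pullback (B' D' B D : C) (p' : Hom B' D') (b : Hom B' B)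
    (d : Hom D' D) (p : Hom B D) : Prop :=
  p ∘ b = d ∘ p' /\
  forall (X : C) (x : Hom X B) (y : Hom X D'), p ∘ x = d ∘ y ->
    exists! z : Hom X B', b ∘ z = x /\ p' ∘ z = y.

(* [E i p] : the pair 0 -> A -i-> B -p-> D -> 0 is a conflation. *)
Definition conflations := forall A B D : C, Hom A B -> Hom B D -> Prop.

Variable E : conflations.

Definition inflation (A B : C) (i : Hom A B) : Prop :=
  exists (D : C) (p : Hom B D), E i p.

Definition deflation (B D : C) (p : Hom B D) : Prop :=
  exists (A : C) (i : Hom A B), E i p.

(* Quillen's axioms, in Bühler's form. *)
Record is_exact_category : Prop := IsExactCategory {
  ex_additive : is_additive C;
  ex_kercoker : forall (A B D : C) (i : Hom A B) (p : Hom B D),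
    E i p -> is_kernel i p /\ is_cokernel i p;
  ex_iso : forall (A B D A' B' D' : C) (i : Hom A B) (p : Hom B D)
      (i' : Hom A' B') (p' : Hom B' D')
      (a : Hom A A') (b : Hom B B') (d : Hom D D'),
    is_iso a -> is_iso b -> is_iso d ->
    b ∘ i = i' ∘ a -> d ∘ p = p' ∘ b -> E i p -> E i' p';
  ex_id_infl : forall A : C, inflation (idm A);
  ex_id_defl : forall A : C, deflation (idm A);
  ex_comp_infl : forall (A B D : C) (i : Hom A B) (j : Hom B D),
    inflation i -> inflation j -> inflation (j ∘ i);
  ex_comp_defl : forall (A B D : C) (p : Hom A B) (q : Hom B D),
    deflation p -> deflation q -> deflation (q ∘ p);
  ex_pushout : forall (A B A' : C) (i : Hom A B) (a : Hom A A'),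
    inflation i -> exists (B' : C) (b : Hom B B') (i' : Hom A' B'),
      is_pushout i a b i' /\ inflation i';
  ex_pullback : forall (B D D' : C) (p : Hom B D) (d : Hom D' D),
    deflation p -> exists (B' : C) (p' : Hom B' D') (b : Hom B' B),
      is_pullback p' b d p /\ deflation p' }.

Definition projective (Q : C) : Prop :=
  forall (B D : C) (p : Hom B D) (f : Hom Q D), deflation p ->
    exists g : Hom Q B, p ∘ g = f.

Definition injective_ob (I : C) : Prop :=
  forall (A B : C) (i : Hom A B) (f : Hom A I), inflation i ->
    exists g : Hom B I, g ∘ i = f.

Definition enough_projectives : Prop :=
  forall A : C, exists (Q : C) (p : Hom Q A), projective Q /\ deflation p.

Definition enough_injectives : Prop :=
  forall A : C, exists (I : C) (i : Hom A I), injective_ob I /\ inflation i.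

Record is_frobenius : Prop := IsFrobenius {
  frob_exact : is_exact_category;
  frob_proj : enough_projectives;
  frob_inj : enough_injectives;
  frob_projinj : forall A : C, projective A <-> injective_ob A }.

End Exact.

(* Additivity is part of [functor]. *)
Definition is_exact_functor (C D : precat) (EC : conflations C)
    (ED : conflations D) (F : functor C D) : Prop :=
  forall (A B X : C) (i : Hom A B) (p : Hom B X),
    EC A B X i p -> ED (F A) (F B) (F X) (fmap F i) (fmap F p).

Section Triangulated.
Variables (T : precat) (S : functor T T).

(* [Delta f g h] : the sextuple A -f-> B -g-> C -h-> S A is distinguished. *)
Definition triangles :=
  forall A B C : T, Hom A B -> Hom B C -> Hom C (S A) -> Prop.

(* The suspension is an auto-equivalence, not necessarily an automorphism, so
   rotation is stated as an equivalence. *)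
Record is_triangulated (Delta : triangles) : Prop := IsTriangulated {
  tr_additive : is_additive T;
  tr_suspension : is_autoequivalence S;
  tr_iso : forall (A B C A' B' C' : T)
      (f : Hom A B) (g : Hom B C) (h : Hom C (S A))
      (f' : Hom A' B') (g' : Hom B' C') (h' : Hom C' (S A'))
      (a : Hom A A') (b : Hom B B') (c : Hom C C'),
    is_iso a -> is_iso b -> is_iso c ->
    b ∘ f = f' ∘ a -> c ∘ g = g' ∘ b -> fmap S a ∘ h = h' ∘ c ->
    Delta A B C f g h -> Delta A' B' C' f' g' h';
  tr_id : forall A Z : T, is_zero Z -> Delta A A Z (idm A) 0 0;
  tr_cone : forall (A B : T) (f : Hom A B),
    exists (C : T) (g : Hom B C) (h : Hom C (S A)), Delta A B C f g h;
  tr_rot : forall (A B C : T) (f : Hom A B) (g : Hom B C) (h : Hom C (S A)),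
    Delta A B C f g h <-> Delta B C (S A) g h (- fmap S f);
  tr_mor : forall (A B C A' B' C' : T)
      (f : Hom A B) (g : Hom B C) (h : Hom C (S A))
      (f' : Hom A' B') (g' : Hom B' C') (h' : Hom C' (S A'))
      (a : Hom A A') (b : Hom B B'),
    Delta A B C f g h -> Delta A' B' C' f' g' h' -> b ∘ f = f' ∘ a ->
    exists c : Hom C C', c ∘ g = g' ∘ b /\ fmap S a ∘ h = h' ∘ c;
  tr_oct : forall (A B C D E F : T) (f : Hom A B) (g : Hom B C)
      (f1 : Hom B D) (f2 : Hom D (S A))
      (e1 : Hom C E) (e2 : Hom E (S A))
      (g1 : Hom C F) (g2 : Hom F (S B)),
    Delta A B D f f1 f2 -> Delta A C E (g ∘ f) e1 e2 ->
    Delta B C F g g1 g2 ->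
    exists (u : Hom D E) (v : Hom E F),
      [/\ Delta D E F u v (fmap S f1 ∘ g2),
          u ∘ f1 = e1 ∘ g, e2 ∘ u = f2,
          v ∘ e1 = g1 & g2 ∘ v = fmap S f ∘ e2] }.

Definition has_triangulated_structure : Prop :=
  exists Delta : triangles, is_triangulated Delta.

End Triangulated.

(* Finite-dimensional morphism spaces: this is what makes the representable
   functors take values in mod k. *)
Record klincat (k : fieldType) := Klincat {
  kob : Type;
  kHom : kob -> kob -> vectType k;
  kid : forall A, kHom A A;
  kcmp : forall A B C, kHom B C -> kHom A B -> kHom A C;
  kcmp1m : forall A B (f : kHom A B), kcmp (kid B) f = f;
  kcmpm1 : forall A B (f : kHom A B), kcmp f (kid A) = f;
  kcmpA : forall A B C D (h : kHom C D) (g : kHom B C) (f : kHom A B),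
    kcmp h (kcmp g f) = kcmp (kcmp h g) f;
  kcmpPl : forall A B C (a : k) (g g' : kHom B C) (f : kHom A B),
    kcmp (a *: g + g') f = a *: kcmp g f + kcmp g' f;
  kcmpPr : forall A B C (a : k) (g : kHom B C) (f f' : kHom A B),
    kcmp g (a *: f + f') = a *: kcmp g f + kcmp g f' }.

Arguments kHom {k _} _ _ : rename.
Arguments kid {k _} _ : rename.
Arguments kcmp {k _ A B C} _ _ : rename.

Section KlinPrecat.
Variables (k : fieldType) (P : klincat k).

Fact kcmpDl (A B C : kob P) (g g' : kHom B C) (f : kHom A B) :
  kcmp (g + g') f = kcmp g f + kcmp g' f.
Proof. by rewrite -[g]scale1r kcmpPl !scale1r. Qed.

Fact kcmpDr (A B C : kob P) (g : kHom B C) (f f' : kHom A B) :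
  kcmp g (f + f') = kcmp g f + kcmp g f'.
Proof. by rewrite -[f]scale1r kcmpPr !scale1r. Qed.

Definition precat_of_klin : precat :=
  @Precat (kob P) (fun A B => kHom A B) (@kid k P) (@kcmp k P)
    (@kcmp1m k P) (@kcmpm1 k P) (@kcmpA k P) kcmpDl kcmpDr.
End KlinPrecat.

Coercion precat_of_klin : klincat >-> precat.

Section ModP.
Variables (k : fieldType) (P : klincat k).

(* k-linear contravariant functors from P to mod k (encoded as vectType k). *)
Record cfun := Cfun {
  cob :> kob P -> vectType k;
  cmap : forall A B : kob P, kHom A B -> 'Hom(cob B, cob A);
  cmap1 : forall A, cmap (kid A) = \1%VF;
  cmapM : forall A B C (g : kHom B C) (f : kHom A B),
    cmap (kcmp g f) = (cmap f \o cmap g)%VF;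
  cmapP : forall A B (a : k) (f g : kHom A B),
    cmap (a *: f + g) = a *: cmap f + cmap g }.

Record cnat (M N : cfun) := Cnat {
  cnc :> forall A, 'Hom(M A, N A);
  cncP : forall A B (f : kHom A B),
    (cnc A \o cmap M f = cmap N f \o cnc B)%VF }.

Lemma cnat_eq (M N : cfun) (s t : cnat M N) : (forall A, s A = t A) -> s = t.
Proof.
case: s t => [s sP] [t tP] /= st.
have e : s = t by apply: functional_extensionality_dep.
by case: _ / e tP => tP; rewrite (Prop_irrelevance sP tP).
Qed.

HB.instance Definition _ (M N : cfun) := gen_eqMixin (cnat M N).
HB.instance Definition _ (M N : cfun) := gen_choiceMixin (cnat M N).

Section CnatZmod.
Variables M N : cfun.

Fact cnat0P A B (f : kHom A B) :
  ((0 : 'Hom(M A, N A)) \o cmap M f = cmap N f \o (0 : 'Hom(M B, N B)))%VF.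
Proof. by rewrite comp_lfun0l comp_lfun0r. Qed.
Definition cnat0 := Cnat cnat0P.

Fact cnat_oppP (s : cnat M N) A B (f : kHom A B) :
  ((- s A) \o cmap M f = cmap N f \o (- s B))%VF.
Proof. by rewrite comp_lfunNl comp_lfunNr cncP. Qed.
Definition cnat_opp s := Cnat (cnat_oppP s).

Fact cnat_addP (s t : cnat M N) A B (f : kHom A B) :
  ((s A + t A) \o cmap M f = cmap N f \o (s B + t B))%VF.
Proof. by rewrite comp_lfunDl comp_lfunDr !cncP. Qed.
Definition cnat_add s t := Cnat (cnat_addP s t).

Fact cnat_addA : associative cnat_add.
Proof. by move=> r s t; apply: cnat_eq => A /=; rewrite addrA. Qed.
Fact cnat_addC : commutative cnat_add.
Proof. by move=> s t; apply: cnat_eq => A /=; rewrite addrC. Qed.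
Fact cnat_add0 : left_id cnat0 cnat_add.
Proof. by move=> s; apply: cnat_eq => A /=; rewrite add0r. Qed.
Fact cnat_addN : left_inverse cnat0 cnat_opp cnat_add.
Proof. by move=> s; apply: cnat_eq => A /=; rewrite addNr. Qed.

HB.instance Definition _ := GRing.isZmodule.Build (cnat M N)
  cnat_addA cnat_addC cnat_add0 cnat_addN.
End CnatZmod.

Fact cnat_idP (M : cfun) A B (f : kHom A B) :
  (\1 \o cmap M f = cmap M f \o \1)%VF.
Proof. by rewrite comp_lfun1l comp_lfun1r. Qed.
Definition cnat_id M := Cnat (@cnat_idP M).

Fact cnat_compP (L M N : cfun) (t : cnat M N) (s : cnat L M) A B
    (f : kHom A B) :
  ((t A \o s A) \o cmap L f = cmap N f \o (t B \o s B))%VF.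
Proof. by rewrite -comp_lfunA cncP comp_lfunA cncP comp_lfunA. Qed.
Definition cnat_comp L M N (t : cnat M N) (s : cnat L M) :=
  Cnat (cnat_compP t s).

Definition exact_at (L M N : cfun) (s : cnat L M) (t : cnat M N) : Prop :=
  forall A, limg (s A) = lker (t A).
Definition pmono (M N : cfun) (s : cnat M N) : Prop :=
  forall A, lker (s A) = 0%VS.
Definition pepi (M N : cfun) (s : cnat M N) : Prop :=
  forall A, limg (s A) = fullv.

(* The representable functor Hom(-, A). *)
Section Yoneda.
Variable A : kob P.

Definition precomp (X Y : kob P) (f : kHom X Y) (g : kHom Y A) : kHom X A :=
  kcmp g f.

Fact precomp_linear (X Y : kob P) (f : kHom X Y) : linear (precomp f).
Proof. by move=> a g h; rewrite /precomp kcmpPl. Qed.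

HB.instance Definition _ (X Y : kob P) (f : kHom X Y) :=
  GRing.isLinear.Build k (kHom Y A) (kHom X A) _ (precomp f)
    (precomp_linear f).

Definition rep_map (X Y : kob P) (f : kHom X Y) : 'Hom(kHom Y A, kHom X A) :=
  linfun (precomp f).

Lemma rep_mapE (X Y : kob P) (f : kHom X Y) g : rep_map f g = kcmp g f.
Proof. by rewrite lfunE. Qed.

Fact rep_map1 X : rep_map (kid X) = \1%VF.
Proof. by apply/lfunP => g; rewrite rep_mapE kcmpm1 id_lfunE. Qed.

Fact rep_mapM X Y Z (g : kHom Y Z) (f : kHom X Y) :
  rep_map (kcmp g f) = (rep_map f \o rep_map g)%VF.
Proof. by apply/lfunP => h; rewrite comp_lfunE !rep_mapE kcmpA. Qed.

Fact rep_mapP X Y (a : k) (f g : kHom X Y) :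
  rep_map (a *: f + g) = a *: rep_map f + rep_map g.
Proof.
by apply/lfunP => h; rewrite add_lfunE scale_lfunE !rep_mapE kcmpPr.
Qed.

Definition rep : cfun :=
  @Cfun (fun X => kHom X A) rep_map rep_map1 rep_mapM rep_mapP.
End Yoneda.

Section YonedaMap.
Variables (A B : kob P) (u : kHom A B).

Definition postcomp (X : kob P) (g : kHom X A) : kHom X B := kcmp u g.

Fact postcomp_linear (X : kob P) : linear (@postcomp X).
Proof. by move=> a g h; rewrite /postcomp kcmpPr. Qed.

HB.instance Definition _ (X : kob P) :=
  GRing.isLinear.Build k (kHom X A) (kHom X B) _ (@postcomp X)
    (@postcomp_linear X).

Definition rep_post (X : kob P) : 'Hom(rep A X, rep B X) :=
  linfun (@postcomp X).

Lemma rep_postE X g : rep_post X g = kcmp u g.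
Proof. by rewrite lfunE. Qed.

Fact rep_postP X Y (f : kHom X Y) :
  (rep_post X \o cmap (rep A) f = cmap (rep B) f \o rep_post Y)%VF.
Proof.
apply/lfunP => g.
by rewrite !comp_lfunE rep_postE /= !rep_mapE rep_postE kcmpA.
Qed.

Definition rep_nat : cnat (rep A) (rep B) := Cnat rep_postP.
End YonedaMap.

(* When P is additive, a finite direct sum of representables is representable,
   so one representable on each side suffices. *)
Definition finitely_presented (M : cfun) : Prop :=
  exists (B A : kob P) (r : cnat (rep B) (rep A)) (p : cnat (rep A) M),
    exact_at r p /\ pepi p.

Fact rep_fp A : finitely_presented (rep A).
Proof.
exists A, A, 0, (cnat_id (rep A)); split=> X /=.
  rewrite lim0g; apply/esym/eqP; rewrite -subv0; apply/subvP=> v.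
  by rewrite memv_ker id_lfunE memv0.
by rewrite lim1g.
Qed.

Record fpfun := Fpfun {
  fpval :> cfun;
  fpP : finitely_presented fpval }.

Section ModLaws.
Variables L M N Q : fpfun.

Fact mod_1m (s : cnat M N) : cnat_comp (cnat_id N) s = s.
Proof. by apply: cnat_eq => A /=; rewrite comp_lfun1l. Qed.
Fact mod_m1 (s : cnat M N) : cnat_comp s (cnat_id M) = s.
Proof. by apply: cnat_eq => A /=; rewrite comp_lfun1r. Qed.
Fact mod_A (t : cnat N Q) (s : cnat M N) (r : cnat L M) :
  cnat_comp t (cnat_comp s r) = cnat_comp (cnat_comp t s) r.
Proof. by apply: cnat_eq => A /=; rewrite comp_lfunA. Qed.
Fact mod_Dl (t t' : cnat M N) (s : cnat L M) :
  cnat_comp (t + t') s = cnat_comp t s + cnat_comp t' s.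
Proof. by apply: cnat_eq => A /=; rewrite comp_lfunDl. Qed.
Fact mod_Dr (t : cnat M N) (s s' : cnat L M) :
  cnat_comp t (s + s') = cnat_comp t s + cnat_comp t s'.
Proof. by apply: cnat_eq => A /=; rewrite comp_lfunDr. Qed.
End ModLaws.

Definition modP : precat :=
  @Precat fpfun (fun M N => cnat M N) cnat_id
    (fun L M N => @cnat_comp L M N) mod_1m mod_m1 mod_A mod_Dl mod_Dr.

Definition Yo (A : P) : modP := Fpfun (rep_fp A).

Definition Yo_map (A B : P) (u : Hom A B) : Hom (Yo A) (Yo B) := rep_nat u.

Fact Yo1 A : Yo_map (idm A) = idm (Yo A).
Proof.
by apply: cnat_eq => X; apply/lfunP => g; rewrite rep_postE id_lfunE kcmp1m.
Qed.

Fact YoM (A B C : P) (v : Hom B C) (u : Hom A B) :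
  Yo_map (v ∘ u) = Yo_map v ∘ Yo_map u.
Proof.
apply: cnat_eq => X; apply/lfunP => g.
by rewrite comp_lfunE !rep_postE -kcmpA.
Qed.

Fact YoD (A B : P) (u v : Hom A B) : Yo_map (u + v) = Yo_map u + Yo_map v.
Proof.
apply: cnat_eq => X; apply/lfunP => g.
by rewrite add_lfunE !rep_postE kcmpDl.
Qed.

Definition yoneda : functor P modP := @Functor P modP Yo Yo_map Yo1 YoM YoD.

(* The exact structure that mod P inherits as an extension-closed subcategory
   of the category of all k-linear functors. *)
Definition pointwise_ses : conflations modP :=
  fun L M N s t => [/\ pmono s, exact_at s t & pepi t].

Definition mod_exact (F : functor modP modP) : Prop :=
  is_exact_functor pointwise_ses pointwise_ses F.

Definition values_in_proj (F : functor modP modP) : Prop :=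
  forall M : modP, exists A : P, isomorphic (F M) (yoneda A).

(* [S'] restricts to [S] along the Yoneda functor; an exact such [S'] is
   unique up to natural isomorphism. *)
Definition extends (S : functor P P) (S' : functor modP modP) : Prop :=
  nat_isomorphic (compF S' yoneda) (compF yoneda S).

(* 0 -> F0 -> F1 -> F2 -> F3 -> F4 -> 0 is exact, evaluated at each M of mod P
   and then at each object of P. *)
Definition exact_seq5 (F0 F1 F2 F3 F4 : functor modP modP)
    (d0 : nattrans F0 F1) (d1 : nattrans F1 F2) (d2 : nattrans F2 F3)
    (d3 : nattrans F3 F4) : Prop :=
  forall M : modP,
    [/\ pmono (d0 M), exact_at (d0 M) (d1 M), exact_at (d1 M) (d2 M),
        exact_at (d2 M) (d3 M) & pepi (d3 M)].

End ModP.

Arguments modP {k} P.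
Arguments pointwise_ses {k P}.

(* Main.v *)
(* A sextuple A -f-> B -g-> C -h-> SA in P is declared distinguished when it is
   exact after Yoneda and, with K = ker f, the standard sequence
   K -> X0 K -> X1 K -> X2 K -> S'K maps to K -> A -> B -> C -> S'K by a chain
   map that is the identity on K and on S'K.  As representables are projective and
   injective in mod P, such chain maps can be built and modified one degree at a
   time; the sign in the rotation axiom comes out of the exact sequence
   0 -> X K -> X A -> X (im f) -> 0 of complexes.  For the octahedron on f and g,
   the kernels of f, gf and g form an exact sequence 0 -> K -> L -> N -> M -> 0
   with M the kernel of the map u : cone f -> cone gf, and the comparison map out
   of X M is obtained from compatible choices of those out of X K, X L, X N.
   Kernels of maps between representables are finitely presented because every
   projective object of mod P is injective, hence a summand of some X0 Q, so that
   deflations from projectives can be compared with arbitrary pointwise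
   epimorphisms. *)
From HB Require Import structures.
From mathcomp Require Import all_boot all_algebra.
From mathcomp Require Import boolp.
Require Import Defs.

Set Implicit Arguments.
Unset Strict Implicit.
Unset Printing Implicit Defensive.

Import GRing.Theory.
Local Open Scope ring_scope.
Local Open Scope cat_scope.

(** * Additive calculus in preadditive categories *)

Section PrecatTheory.
Variable C : precat.

Lemma cmpm0 (A B D : C) (g : Hom B D) : g ∘ (0 : Hom A B) = 0.
Proof. by apply: (addrI (g ∘ 0)); rewrite -cmpDr !addr0. Qed.

Lemma cmp0m (A B D : C) (f : Hom A B) : (0 : Hom B D) ∘ f = 0.
Proof. by apply: (addrI (0 ∘ f)); rewrite -cmpDl !addr0. Qed.

Lemma cmpmN (A B D : C) (g : Hom B D) (f : Hom A B) : g ∘ (- f) = - (g ∘ f).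
Proof. by apply: (addrI (g ∘ f)); rewrite -cmpDr !subrr cmpm0. Qed.

Lemma cmpNm (A B D : C) (g : Hom B D) (f : Hom A B) : (- g) ∘ f = - (g ∘ f).
Proof. by apply: (addrI (g ∘ f)); rewrite -cmpDl !subrr cmp0m. Qed.

Lemma cmpBr (A B D : C) (g : Hom B D) (f f' : Hom A B) :
  g ∘ (f - f') = g ∘ f - g ∘ f'.
Proof. by rewrite cmpDr cmpmN. Qed.

Lemma cmpBl (A B D : C) (g g' : Hom B D) (f : Hom A B) :
  (g - g') ∘ f = g ∘ f - g' ∘ f.
Proof. by rewrite cmpDl cmpNm. Qed.

(** Composites nest to the left, so [a ∘ b] is not a subterm of [z ∘ a ∘ b]; this form makes an
    equation for it usable there. *)
Lemma cmp_rw (A B D E : C) (z : Hom D E) (a : Hom B D) (b : Hom A B) c :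
  a ∘ b = c -> z ∘ a ∘ b = z ∘ c.
Proof. by move=> <-; rewrite cmpA. Qed.

Lemma iso_epi (A B D : C) (a : Hom A B) (u v : Hom B D) :
  is_iso a -> u ∘ a = v ∘ a -> u = v.
Proof.
move=> [a' [_ aa']] e.
by rewrite -[u]cmpm1 -[v]cmpm1 -aa' !cmpA e.
Qed.

Lemma is_iso_idm (A : C) : is_iso (idm A).
Proof. by exists (idm A); rewrite cmp1m. Qed.

End PrecatTheory.

Section FunctorTheory.
Variables (C D : precat) (F : functor C D).

Lemma fmap0 (A B : C) : fmap F (0 : Hom A B) = 0.
Proof. by apply: (addrI (fmap F 0)); rewrite -fmapD !addr0. Qed.

Lemma fmapN (A B : C) (f : Hom A B) : fmap F (- f) = - fmap F f.
Proof. by apply: (addrI (fmap F f)); rewrite -fmapD !subrr fmap0. Qed.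

Lemma fmap_iso (A B : C) (a : Hom A B) : is_iso a -> is_iso (fmap F a).
Proof.
by move=> [b [ba ab]]; exists (fmap F b); rewrite -!fmapM ba ab !fmap1.
Qed.

End FunctorTheory.

(** * Exactness tested on a class of objects *)

(* Maps out of objects of [pj] play the role of elements. *)
Section TestExactness.
Variables (E : precat) (pj : E -> Prop).

Definition t_mono (L M : E) (s : Hom L M) : Prop :=
  forall T (x : Hom T L), pj T -> s ∘ x = 0 -> x = 0.

Definition t_epi (M N : E) (t : Hom M N) : Prop :=
  forall T (x : Hom T N), pj T -> exists y : Hom T M, t ∘ y = x.

Definition t_exact (L M N : E) (s : Hom L M) (t : Hom M N) : Prop :=
  t ∘ s = 0 /\
  forall T (x : Hom T M), pj T -> t ∘ x = 0 -> exists y : Hom T L, s ∘ y = x.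

Definition t_ses (L M N : E) (s : Hom L M) (t : Hom M N) : Prop :=
  [/\ t_mono s, t_exact s t & t_epi t].

Definition t_exact_functor (F : functor E E) : Prop :=
  forall (L M N : E) (s : Hom L M) (t : Hom M N),
    t_ses s t -> t_ses (fmap F s) (fmap F t).

Lemma t_mono_comp (K L M : E) (s : Hom L M) (r : Hom K L) :
  t_mono s -> t_mono r -> t_mono (s ∘ r).
Proof.
by move=> sm rm T x pT; rewrite -cmpA => /(sm _ _ pT) /(rm _ _ pT).
Qed.

Lemma t_exact_mono (L M N Q : E) (s : Hom L M) (t : Hom M N) (j : Hom N Q) :
  t_mono j -> t_exact s t -> t_exact s (j ∘ t).
Proof.
move=> jm [ts st]; split=> [|T x pT]; first by rewrite -cmpA ts cmpm0.
by rewrite -cmpA => /(jm _ _ pT) /(st _ _ pT).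
Qed.

Lemma t_exact_epi (K L M N : E) (r : Hom K L) (s : Hom L M) (t : Hom M N) :
  t_epi r -> t_exact s t -> t_exact (s ∘ r) t.
Proof.
move=> re [ts st]; split=> [|T x pT]; first by rewrite cmpA ts cmp0m.
move=> /(st _ _ pT) [y <-]; have [z <-] := re _ y pT.
by exists z; rewrite cmpA.
Qed.

Lemma t_exact_opp (L M N : E) (s : Hom L M) (t : Hom M N) :
  t_exact s t -> t_exact s (- t).
Proof.
move=> [ts st]; split=> [|T x pT]; first by rewrite cmpNm ts oppr0.
by rewrite cmpNm => /eqP; rewrite oppr_eq0 => /eqP; apply: st.
Qed.

Lemma t_exact_oppl (L M N : E) (s : Hom L M) (t : Hom M N) :
  t_exact s t -> t_exact (- s) t.
Proof.
move=> [ts st]; split=> [|T x pT]; first by rewrite cmpmN ts oppr0.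
by move=> /(st _ _ pT) [y <-]; exists (- y); rewrite cmpNm cmpmN opprK.
Qed.

Lemma t_exact_iso (L M N L' M' N' : E) (s : Hom L M) (t : Hom M N)
    (s' : Hom L' M') (t' : Hom M' N')
    (a : Hom L L') (b : Hom M M') (c : Hom N N') :
  is_iso a -> is_iso b -> is_iso c -> b ∘ s = s' ∘ a -> c ∘ t = t' ∘ b ->
  t_exact s t -> t_exact s' t'.
Proof.
move=> ia [b' [b'b bb']] [c' [c'c cc']] es et [ts st]; split.
  by apply: (iso_epi ia); rewrite -cmpA -es cmpA -et -cmpA ts cmp0m cmpm0.
move=> T x pT tx.
have [|y sy] := st T (b' ∘ x) pT.
  by rewrite -[t]cmp1m -c'c -(cmpA c') et -!cmpA (cmpA b) bb' cmp1m tx cmpm0.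
by exists (a ∘ y); rewrite cmpA -es -cmpA sy cmpA bb' cmp1m.
Qed.

Hypothesis sep : forall (M N : E) (t : Hom M N),
  (forall T (x : Hom T M), pj T -> t ∘ x = 0) -> t = 0.

Lemma t_monoP (K L M : E) (s : Hom L M) (u v : Hom K L) :
  t_mono s -> s ∘ u = s ∘ v -> u = v.
Proof.
move=> sm e; apply/eqP; rewrite -subr_eq0; apply/eqP; apply: sep => T x pT.
by apply: (sm _ _ pT); rewrite cmpA cmpBr e subrr cmp0m.
Qed.

Lemma t_epiP (M N Q : E) (t : Hom M N) (u v : Hom N Q) :
  t_epi t -> u ∘ t = v ∘ t -> u = v.
Proof.
move=> te e; apply/eqP; rewrite -subr_eq0; apply/eqP; apply: sep => T x pT.
have [y <-] := te _ x pT.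
by rewrite cmpA cmpBl e subrr cmp0m.
Qed.

End TestExactness.

(** Naturality recovers [u ∘ t A] from [fmap G (fmap F u)], and [t A] can be cancelled. *)
Lemma autoequivalence_faithful (C : precat) (F : functor C C) (A B : C)
    (f g : Hom A B) : is_autoequivalence F -> fmap F f = fmap F g -> f = g.
Proof.
move=> [G [_ [t it]]] e; apply: (iso_epi (it A)).
have tE (u : Hom A B) : u ∘ t A = t B ∘ fmap G (fmap F u) by rewrite -(ntcP t u).
by rewrite !tE e.
Qed.

Lemma autoequivalence_sym (C : precat) (F G : functor C C) :
  nat_isomorphic (compF F G) (idF C) -> nat_isomorphic (compF G F) (idF C) ->
  is_autoequivalence G.
Proof. by move=> FG GF; exists F. Qed.

(** The preimage is [fmap G u] conjugated by the isomorphism from G F to the identity. Applying [G]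
    to [fmap F f] and to [u] gives the same map, and [G] is faithful. *)
Lemma autoequivalence_full (C : precat) (F : functor C C) (A B : C)
    (u : Hom (F A) (F B)) : is_autoequivalence F -> exists f, fmap F f = u.
Proof.
move=> [G [FG [t it]]].
have GF : nat_isomorphic (compF G F) (idF C) by exists t.
have [t' [t't tt']] := it A; pose f := t B ∘ fmap G u ∘ t'.
exists f; apply: (autoequivalence_faithful (autoequivalence_sym FG GF)).
have [s [st ts]] := it B.
have : t B ∘ fmap G (fmap F f) = f ∘ t A by exact: (ntcP t f).
rewrite -(cmpA _ t') t't cmpm1 => /(congr1 (fun z => s ∘ z)).
by rewrite !cmpA st !cmp1m.
Qed.

(** * Triangles on projective-injective objects *)

Section ProjectiveTriangles.
Variables (E : precat) (pj : E -> Prop).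

Local Notation mono := (t_mono pj).
Local Notation epi := (t_epi pj).
Local Notation exact := (t_exact pj).
Local Notation ses := (t_ses pj).

Definition t_kernel (K A B : E) (i : Hom K A) (f : Hom A B) : Prop :=
  mono i /\ exact i f.

Hypothesis sep : forall (M N : E) (t : Hom M N),
  (forall T (x : Hom T M), pj T -> t ∘ x = 0) -> t = 0.
(** Injectivity in the form used throughout: [u] factors through the cokernel of [s], which embeds
    in [N], and then extends to [N]. *)
Hypothesis pj_inj : forall (L M N I : E) (s : Hom L M) (t : Hom M N)
  (u : Hom M I), pj I -> exact s t -> u ∘ s = 0 ->
  exists v : Hom N I, v ∘ t = u.
Hypothesis pj_ker : forall (A B : E) (f : Hom A B), pj A -> pj B ->
  exists (K : E) (i : Hom K A), t_kernel i f.
Hypothesis ker_lift : forall (L M N Z : E) (s : Hom L M) (t : Hom M N)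
  (x : Hom Z M), mono s -> exact s t -> t ∘ x = 0 -> exists y, s ∘ y = x.
Hypothesis pj_biprod : forall A B : E, pj A -> pj B ->
  exists (X : E) (i1 : Hom A X) (i2 : Hom B X) (p1 : Hom X A) (p2 : Hom X B),
  pj X /\ is_biproduct i1 i2 p1 p2.
Hypothesis pj_split : forall (A : E) (e : Hom A A), pj A -> e ∘ e = e ->
  exists (B : E) (r : Hom A B) (s : Hom B A),
  [/\ pj B, s ∘ r = e & r ∘ s = idm B].

(** A monomorphism is exact after a zero map, so this is [pj_inj] with first map zero. *)
Lemma pj_extend (L M I : E) (s : Hom L M) (u : Hom L I) :
  pj I -> mono s -> exists v : Hom M I, v ∘ s = u.
Proof.
move=> pI sm; apply: (pj_inj (s := (0 : Hom L L))) => //; last by rewrite cmpm0.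
split=> [|T x pT /(sm _ _ pT) ->]; first by rewrite cmpm0.
by exists 0; rewrite cmpm0.
Qed.

(** Only kernels are assumed to exist, so the image of [f] is presented as the kernel of [g], and
    [p] is the projection of [A] onto it. *)
Lemma coimage (A B D K1 : E) (f : Hom A B) (g : Hom B D) (i1 : Hom K1 B) :
  pj A -> exact f g -> t_kernel i1 g ->
  exists p : Hom A K1, [/\ i1 ∘ p = f, epi p &
    forall (K : E) (i : Hom K A), t_kernel i f -> ses i p].
Proof.
move=> pA [gf fg] [i1m [gi1 i1g]]; have [p pf] := i1g _ f pA gf.
have pe : epi p.
  move=> T x pT; have [|y fy] := fg _ (i1 ∘ x) pT.
    by rewrite cmpA gi1 cmp0m.
  by exists y; apply: (t_monoP sep i1m); rewrite cmpA pf.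
exists p; split=> // K i [im [fi i_f]]; split=> //; split.
  by apply: (t_monoP sep i1m); rewrite cmpA pf fi cmpm0.
by move=> T x pT px; apply: i_f; rewrite // -pf -cmpA px cmpm0.
Qed.

(** * Exact functors applied to longer exact sequences *)

Section ExactFunctor.
Variable F : functor E E.
Hypothesis F_exact : t_exact_functor pj F.

(** The terms after [f] ensure that [fmap F i1] is mono: [i1] begins the short exact sequence ker g
    -> B -> ker h, and [F] preserves it. *)
Lemma exact_functor_ker (A B C D K : E) (f : Hom A B) (g : Hom B C)
    (h : Hom C D) (i : Hom K A) : pj A -> pj B -> pj C -> pj D ->
  exact f g -> exact g h -> t_kernel i f -> exact (fmap F i) (fmap F f).
Proof.
move=> pA pB pC pD fg gh ki.
have [K1 [i1 k1]] := pj_ker g pB pC; have [K2 [i2 k2]] := pj_ker h pC pD.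
have [p [pf _ /(_ _ _ ki) sip]] := coimage pA fg k1.
have [q [_ _ /(_ _ _ k1) siq]] := coimage pB gh k2.
have [_ ip _] := F_exact sip; have [i1m _ _] := F_exact siq.
by rewrite -pf fmapM; apply: t_exact_mono.
Qed.

(** [fmap F f] is an epi onto F (ker g) followed by the inclusion of the kernel of [fmap F g];
    identifying that kernel takes the two terms after [g]. *)
Lemma exact_functor_exact (A B C D G : E) (f : Hom A B) (g : Hom B C)
    (h : Hom C D) (j : Hom D G) : pj A -> pj B -> pj C -> pj D -> pj G ->
  exact f g -> exact g h -> exact h j -> exact (fmap F f) (fmap F g).
Proof.
move=> pA pB pC pD pG fg gh hj.
have [K [i ki]] := pj_ker f pA pB; have [K1 [i1 k1]] := pj_ker g pB pC.
have [p [pf _ /(_ _ _ ki) sip]] := coimage pA fg k1.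
have [_ _ pe] := F_exact sip.
rewrite -pf fmapM; apply: t_exact_epi => //.
exact: exact_functor_ker pB pC pD pG gh hj k1.
Qed.

End ExactFunctor.

(** * The sequence Id -> X0 -> X1 -> X2 -> S and the distinguished sextuples *)

Variables S X0 X1 X2 : functor E E.
Hypotheses (S_exact : t_exact_functor pj S) (X0_exact : t_exact_functor pj X0)
  (X1_exact : t_exact_functor pj X1) (X2_exact : t_exact_functor pj X2).
Hypothesis pj_S : forall A, pj A -> pj (S A).
Hypotheses (pj_X0 : forall M, pj (X0 M)) (pj_X1 : forall M, pj (X1 M))
  (pj_X2 : forall M, pj (X2 M)).
Variables (d0 : forall M, Hom M (X0 M)) (d1 : forall M, Hom (X0 M) (X1 M))
  (d2 : forall M, Hom (X1 M) (X2 M)) (d3 : forall M, Hom (X2 M) (S M)).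
Hypotheses
  (d0N : forall L M (f : Hom L M), d0 M ∘ f = fmap X0 f ∘ d0 L)
  (d1N : forall L M (f : Hom L M), d1 M ∘ fmap X0 f = fmap X1 f ∘ d1 L)
  (d2N : forall L M (f : Hom L M), d2 M ∘ fmap X1 f = fmap X2 f ∘ d2 L)
  (d3N : forall L M (f : Hom L M), d3 M ∘ fmap X2 f = fmap S f ∘ d3 L).
Hypotheses (d0_mono : forall M, mono (d0 M))
  (d01 : forall M, exact (d0 M) (d1 M)) (d12 : forall M, exact (d1 M) (d2 M))
  (d23 : forall M, exact (d2 M) (d3 M)) (d3_epi : forall M, epi (d3 M)).

(* The last equation says that the map induced on [S K] is the identity. *)
Definition compares (A B C K : E) (f : Hom A B) (g : Hom B C) (h : Hom C (S A))
    (i : Hom K A) (a : Hom (X0 K) A) (b : Hom (X1 K) B) (c : Hom (X2 K) C) :=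
  [/\ a ∘ d0 K = i, f ∘ a = b ∘ d1 K, g ∘ b = c ∘ d2 K
    & h ∘ c = fmap S i ∘ d3 K].

(** One kernel with one comparison is required; for [A] and [B] in [pj], [p_triangle_compares] then
    gives a comparison for every kernel of [f]. *)
Definition p_triangle (A B C : E) (f : Hom A B) (g : Hom B C)
    (h : Hom C (S A)) : Prop :=
  [/\ exact f g, exact g h, exact h (fmap S f) &
    exists (K : E) (i : Hom K A) a b c, t_kernel i f /\ compares f g h i a b c].

Lemma d10 M : d1 M ∘ d0 M = 0. Proof. by have [] := d01 M. Qed.
Lemma d21 M : d2 M ∘ d1 M = 0. Proof. by have [] := d12 M. Qed.
Lemma d32 M : d3 M ∘ d2 M = 0. Proof. by have [] := d23 M. Qed.

Section OneTriangle.
Variables (A B C : E) (f : Hom A B) (g : Hom B C) (h : Hom C (S A)).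
Hypotheses (pA : pj A) (pB : pj B) (pC : pj C).

Lemma p_triangle_zero : p_triangle f g h ->
  [/\ g ∘ f = 0, h ∘ g = 0 & fmap S f ∘ h = 0].
Proof. by case=> -[? _] [? _] [? _] _. Qed.

Hypothesis dfgh : p_triangle f g h.

Lemma p_triangle_Sker (K : E) (i : Hom K A) : t_kernel i f ->
  t_kernel (fmap S i) (fmap S f).
Proof.
case: dfgh => fg gh _ _ ki; split; last first.
  exact: (exact_functor_ker S_exact pA pB pC (pj_S pA) fg gh ki).
have [K1 [i1 k1]] := pj_ker g pB pC.
have [p [_ _ /(_ _ _ ki) sip]] := coimage pA fg k1.
by have [] := S_exact sip.
Qed.

Lemma p_triangle_S : exact (fmap S f) (fmap S g).
Proof.
case: dfgh => fg gh hf _.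
by apply: (exact_functor_exact S_exact) hf => //; apply: pj_S.
Qed.

(** The components [a] and [b] can be prescribed: they differ from the given comparison, transported
    along [j], by a homotopy [s1], [s2], and [g ∘ s2] is the matching correction of [c']. The
    octahedron relies on this freedom. *)
Lemma compares_extend (K : E) (i : Hom K A) a b : t_kernel i f ->
  a ∘ d0 K = i -> f ∘ a = b ∘ d1 K -> exists c, compares f g h i a b c.
Proof.
move=> ki ai fa; have [gf hg Sfh] := p_triangle_zero dfgh.
case: dfgh => _ _ _ [K' [i' [a' [b' [c' [[i'm ki'] [ai' fa' gb' hc']]]]]]].
have [j ji] : exists j, i' ∘ j = i.
  by apply: ker_lift i'm ki' _; case: ki => _ [].
have [|s1 s1E] := pj_inj (u := a - a' ∘ fmap X0 j) pA (d01 K).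
  by rewrite cmpBl ai -cmpA -d0N cmpA ai' ji subrr.
have [|s2 s2E] := pj_inj (u := b - b' ∘ fmap X1 j - f ∘ s1) pB (d12 K).
  rewrite !cmpBl -fa -(cmpA b') -d1N (cmpA b') -fa' (cmp_rw _ s1E) cmpBr.
  by rewrite !cmpA subrr.
exists (c' ∘ fmap X2 j + g ∘ s2); split=> //.
  rewrite cmpDl (cmp_rw _ s2E) !cmpBr !cmpA gf cmp0m subr0 gb'.
  by rewrite -(cmpA c') -d2N !cmpA addrC subrK.
by rewrite cmpDr !cmpA hg cmp0m addr0 hc' -cmpA d3N cmpA -fmapM ji.
Qed.

Section Compared.
Variables (K : E) (i : Hom K A) (a : Hom (X0 K) A) (b : Hom (X1 K) B)
  (c : Hom (X2 K) C).
Hypotheses (ki : t_kernel i f) (cmp_abc : compares f g h i a b c).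

(* [C] is the cokernel of [X1 K ⊕ A -> X2 K ⊕ B]. *)
Lemma compares_desc (Z : E) (y : Hom (X2 K) Z) (z : Hom B Z) : pj Z ->
  z ∘ f = 0 -> y ∘ d2 K = z ∘ b -> exists w, w ∘ g = z /\ w ∘ c = y.
Proof.
case: dfgh cmp_abc => fg gh hf _ [ai fa gb hc] pZ zf yd.
have [Sim _] := p_triangle_Sker ki; have [_ hg _] := p_triangle_zero dfgh.
have [w0 w0g] := pj_inj pZ fg zf.
(* The defect [y - w0 ∘ c] vanishes on [d2 K], hence factors through S K, which [fmap S i] embeds in
   S A. The correction [s ∘ h] is invisible along [g]. *)
have [|s sE] := pj_inj (u := y - w0 ∘ c) pZ (t_exact_mono Sim (d23 K)).
  by rewrite cmpBl yd -w0g -!cmpA gb subrr.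
exists (w0 + s ∘ h); split; rewrite cmpDl -cmpA.
  by rewrite hg cmpm0 addr0.
by rewrite hc sE addrC subrK.
Qed.

(** [g] and [c] are jointly epic: a test map into [C] minus a suitable [c ∘ w] is killed by [h],
    hence comes from [B]. *)
Lemma compares_ext (Z : E) (u v : Hom C Z) :
  u ∘ g = v ∘ g -> u ∘ c = v ∘ c -> u = v.
Proof.
case: dfgh cmp_abc => fg [_ gh] [Sfh hf] _ [ai fa gb hc] ug uc.
have [Sim [_ Si]] := p_triangle_Sker ki.
apply/eqP; rewrite -subr_eq0; apply/eqP; apply: sep => T x pT.
have [|k kE] := Si _ (h ∘ x) pT; first by rewrite cmpA Sfh cmp0m.
have [w wE] := d3_epi k pT.
have [|y yE] := gh _ (x - c ∘ w) pT.
  by rewrite cmpBr cmpA hc -cmpA wE kE subrr.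
rewrite -[x](subrK (c ∘ w)) -yE cmpDr !cmpA !cmpBl ug uc.
by rewrite !subrr addr0.
Qed.

End Compared.
End OneTriangle.

Lemma p_triangle_compares (A B C K : E) (f : Hom A B) (g : Hom B C)
    (h : Hom C (S A)) (i : Hom K A) : pj A -> pj B -> p_triangle f g h ->
  t_kernel i f -> exists a b c, compares f g h i a b c.
Proof.
move=> pA pB dfgh ki; have [a ai] := pj_extend i pA (d0_mono (M := K)).
have [|b bE] := pj_inj (u := f ∘ a) pB (d01 K).
  by rewrite -cmpA ai; case: ki => _ [].
have [c cE] := compares_extend pA pB dfgh ki ai (esym bE).
by exists a, b, c.
Qed.

Lemma p_triangle_iso (A B C A' B' C' : E)
    (f : Hom A B) (g : Hom B C) (h : Hom C (S A))
    (f' : Hom A' B') (g' : Hom B' C') (h' : Hom C' (S A'))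
    (u : Hom A A') (v : Hom B B') (w : Hom C C') :
  is_iso u -> is_iso v -> is_iso w ->
  v ∘ f = f' ∘ u -> w ∘ g = g' ∘ v -> fmap S u ∘ h = h' ∘ w ->
  p_triangle f g h -> p_triangle f' g' h'.
Proof.
move=> iu iv iw ef eg eh [fg gh hf [K [i [a [b [c [[im ki] [ai fa gb hc]]]]]]]].
have iSu := fmap_iso S iu; have iSv := fmap_iso S iv.
have idK := is_iso_idm K.
split.
- exact: t_exact_iso iu iv iw ef eg fg.
- exact: t_exact_iso iv iw iSu eg eh gh.
- by apply: t_exact_iso iw iSu iSv eh _ hf; rewrite -!fmapM ef.
exists K, (u ∘ i), (u ∘ a), (v ∘ b), (w ∘ c); split; split.
- apply: t_mono_comp im => T x _ ux; case: iu => u' [u'u _].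
  by rewrite -[x]cmp1m -u'u -cmpA ux cmpm0.
- by apply: t_exact_iso idK iu iv _ ef ki; rewrite cmpm1.
- by rewrite -cmpA ai.
- by rewrite cmpA -ef -cmpA fa cmpA.
- by rewrite cmpA -eg -cmpA gb cmpA.
by rewrite cmpA -eh -cmpA hc cmpA -fmapM.
Qed.

Lemma p_triangle_id (A Z : E) : pj A -> is_zero Z ->
  p_triangle (idm A) (0 : Hom A Z) 0.
Proof.
move=> pA Z0; have [K [i [im ki]]] := pj_ker (idm A) pA pA.
have i0 : i = 0 by rewrite -[i]cmp1m; case: ki.
split; rewrite ?fmap1.
- by split=> [|T x _ _]; [rewrite cmp0m | exists x; rewrite cmp1m].
- split=> [|T x _ _]; first by rewrite cmp0m.
  by exists 0; rewrite cmpm0 -[x]cmp1m Z0 cmp0m.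
- split=> [|T x _]; first by rewrite cmpm0.
  by rewrite cmp1m => ->; exists 0; rewrite cmpm0.
exists K, i, 0, 0, 0; split; first by [].
by split; rewrite ?i0 ?fmap0 ?cmp0m ?cmpm0.
Qed.

(** With [m] induced on the kernels, the two chain maps from X K to the second triangle are
    homotopic through [s1], [s2]. The map [w] is glued from [g' ∘ v] on [B] and the
    homotopy-corrected map on X2 K. *)
Lemma p_triangle_mor (A B C A' B' C' : E)
    (f : Hom A B) (g : Hom B C) (h : Hom C (S A))
    (f' : Hom A' B') (g' : Hom B' C') (h' : Hom C' (S A'))
    (u : Hom A A') (v : Hom B B') :
  pj A -> pj B -> pj C -> pj A' -> pj B' -> pj C' ->
  p_triangle f g h -> p_triangle f' g' h' -> v ∘ f = f' ∘ u ->
  exists w : Hom C C', w ∘ g = g' ∘ v /\ fmap S u ∘ h = h' ∘ w.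
Proof.
move=> pA pB pC pA' pB' pC' dt dt' ef.
have [K [i ki]] := pj_ker f pA pB; have [K' [i' ki']] := pj_ker f' pA' pB'.
have [a [b [c cc]]] := p_triangle_compares pA pB dt ki.
have [a' [b' [c' cc']]] := p_triangle_compares pA' pB' dt' ki'.
have [gf hg Sfh] := p_triangle_zero dt.
have [gf' hg' Sfh'] := p_triangle_zero dt'.
have fi : f ∘ i = 0 by case: ki => _ [].
have [m mE] : exists m, i' ∘ m = u ∘ i.
  case: ki' => im ki'; apply: ker_lift im ki' _.
  by rewrite cmpA -ef -cmpA fi cmpm0.
case: (cc) (cc') => [ai fa gb hc] [ai' fa' gb' hc'].
have [|s1 s1E] := pj_inj (u := u ∘ a - a' ∘ fmap X0 m) pA' (d01 K).
  by rewrite cmpBl -!cmpA ai -d0N (cmpA a') ai' mE subrr.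
have [|s2 s2E] := pj_inj (u := v ∘ b - b' ∘ fmap X1 m - f' ∘ s1) pB' (d12 K).
  rewrite !cmpBl (cmp_rw _ s1E) -(cmpA v) -fa -(cmpA b') -d1N (cmpA b') -fa'.
  by rewrite cmpBr !cmpA ef subrr.
have [||w [wg wc]] := compares_desc pA pB pC dt ki cc
    (y := c' ∘ fmap X2 m + g' ∘ s2) (z := g' ∘ v) pC'.
- by rewrite -cmpA ef cmpA gf' cmp0m.
- rewrite cmpDl (cmp_rw _ s2E) -(cmpA c') -d2N cmpA -gb' !cmpBr !cmpA gf'.
  by rewrite cmp0m subr0 addrC subrK.
exists w; split=> //; apply: (compares_ext pA pB pC dt ki cc).
  by rewrite -!cmpA hg wg cmpm0 cmpA hg' cmp0m.
rewrite -!cmpA hc wc cmpDr !cmpA hg' cmp0m addr0 hc' -fmapM -mE fmapM.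
by rewrite -!cmpA d3N.
Qed.

(* The chain map required for [(g, h, - fmap S f)] measures how far [a], [b],
   [c], extended from [K] to [A], are from being a chain map on [A]; its
   components descend along [A -> im f]. *)
Lemma p_triangle_rot (A B C : E) (f : Hom A B) (g : Hom B C)
    (h : Hom C (S A)) : pj A -> pj B -> pj C ->
  p_triangle f g h -> p_triangle g h (- fmap S f).
Proof.
move=> pA pB pC dt; have [gf hg Sfh] := p_triangle_zero dt.
have [K [i ki]] := pj_ker f pA pB; have [K1 [i1 k1]] := pj_ker g pB pC.
have [a [b [c [ai fa gb hc]]]] := p_triangle_compares pA pB dt ki.
case: (dt) => fg gh hf _.
have [p [pf pe /(_ _ _ ki) sip]] := coimage pA fg k1.
have fi : f ∘ i = 0 by case: ki => _ [].
have [X0i X0ip X0p] := X0_exact sip; have [X1i X1ip X1p] := X1_exact sip.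
have [X2i X2ip X2p] := X2_exact sip.
(* The extension of [a] to X0 A must also retract [d0 A]. [a1] extends [a]; the term
   [n' ∘ fmap X0 p], which vanishes on X0 K, turns it into a retraction [a2]. *)
have [a1 a1E] := pj_extend a pA X0i.
have [||n nE] := pj_inj (u := idm A - a1 ∘ d0 A) pA (s := i) (t := p).
- by case: sip.
- by rewrite cmpBl cmp1m -cmpA d0N cmpA a1E ai subrr.
have [n' n'E] := pj_extend n pA (d0_mono (M := K1)).
pose a2 := a1 + n' ∘ fmap X0 p.
have a2X : a2 ∘ fmap X0 i = a.
  by rewrite cmpDl -cmpA; case: X0ip => -> _; rewrite cmpm0 addr0.
have a2d : a2 ∘ d0 A = idm A.
  by rewrite cmpDl -cmpA -d0N cmpA n'E nE addrC subrK.
have [b2 b2X] := pj_extend b pB X1i; have [c2 c2X] := pj_extend c pC X2i.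
have [|x0 x0E] := pj_inj (u := f ∘ a2 - b2 ∘ d1 A) pB X0ip.
  by rewrite cmpBl -!cmpA a2X d1N cmpA b2X fa subrr.
have [|x1 x1E] := pj_inj (u := c2 ∘ d2 A - g ∘ b2) pC X1ip.
  by rewrite cmpBl -!cmpA b2X d2N cmpA c2X gb subrr.
have [|x2 x2E] := pj_inj (u := h ∘ c2 - d3 A) (pj_S pA) X2ip.
  by rewrite cmpBl -!cmpA c2X d3N hc subrr.
split=> //; first exact: t_exact_opp.
  by apply: t_exact_oppl; apply: p_triangle_S dt.
exists K1, i1, x0, x1, x2; split=> //; split.
- apply: (t_epiP sep pe).
  by rewrite -cmpA d0N cmpA x0E cmpBl -!cmpA a2d d10 cmpm0 subr0 cmpm1.
- apply: (t_epiP sep X0p).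
  rewrite -!cmpA d1N x0E (cmpA x1) x1E cmpBr !cmpBl !cmpA gf -(cmpA c2) d21.
  by rewrite cmp0m cmpm0.
- apply: (t_epiP sep X1p).
  rewrite -!cmpA d2N x1E (cmpA x2) x2E cmpBr !cmpBl !cmpA hg d32.
  by rewrite cmp0m.
(* Since S f ∘ h = 0, only [- d3 A] survives from the defect [h ∘ c2 - d3 A]; this forces the sign
   of [- fmap S f]. *)
apply: (t_epiP sep X2p).
rewrite -!cmpA d3N x2E cmpNm cmpBr opprB !cmpA Sfh cmp0m subr0.
by rewrite -fmapM pf.
Qed.

(* [C] is the cokernel of the cone differential [X1 K ⊕ A -> X2 K ⊕ B]; it lies
   in [pj] because the cone, being exact with injective terms, is split. *)
Lemma p_triangle_cone (A B : E) (f : Hom A B) : pj A -> pj B ->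
  exists (C : E) (g : Hom B C) (h : Hom C (S A)), pj C /\ p_triangle f g h.
Proof.
move=> pA pB; have [K [i ki]] := pj_ker f pA pB.
have [a ai] := pj_extend i pA (d0_mono (M := K)).
have fi : f ∘ i = 0 by case: ki => _ [].
have [|b bE] := pj_inj (u := f ∘ a) pB (d01 K); first by rewrite -cmpA ai.
have [Y1 [i1 [i2 [p1 [p2 [pY1 [p1i1 p2i2 p1i2 p2i1 ip]]]]]]] :=
  pj_biprod (pj_X1 K) pA.
have [Y2 [j1 [j2 [q1 [q2 [pY2 [q1j1 q2j2 q1j2 q2j1 jq]]]]]]] :=
  pj_biprod (pj_X2 K) pB.
(* These are the differentials of the cone of K -> X0 K -> X1 K -> X2 K mapping to K -> A -> B, with
   the two copies of K cancelled. *)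
pose D0 := i1 ∘ d1 K + i2 ∘ a.
pose D1 := j1 ∘ d2 K ∘ p1 + j2 ∘ (b ∘ p1 - f ∘ p2).
have p1D0 : p1 ∘ D0 = d1 K by rewrite cmpDr !cmpA p1i1 p1i2 cmp0m cmp1m addr0.
have p2D0 : p2 ∘ D0 = a by rewrite cmpDr !cmpA p2i1 p2i2 cmp0m cmp1m add0r.
have q1D1 : q1 ∘ D1 = d2 K ∘ p1.
  by rewrite cmpDr !cmpA q1j1 q1j2 cmp0m cmp1m addr0.
have q2D1 : q2 ∘ D1 = b ∘ p1 - f ∘ p2.
  by rewrite cmpDr !cmpA q2j1 q2j2 !cmp0m cmp1m add0r.
have D10 : D1 ∘ D0 = 0.
  rewrite cmpDl -!cmpA cmpBl -!cmpA p1D0 p2D0 d21 bE subrr.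
  by rewrite !cmpm0 addr0.
have D0m : mono D0.
  move=> T x pT D0x.
  have [|y yE] := proj2 (d01 K) _ x pT; first by rewrite -p1D0 -cmpA D0x cmpm0.
  rewrite -yE; suff -> : y = 0 by rewrite cmpm0.
  case: ki => im _; apply: im => //.
  by rewrite -ai -cmpA yE -p2D0 -cmpA D0x cmpm0.
have D01 : exact D0 D1.
  split=> // T x pT D1x.
  have [|z zE] := proj2 (d12 K) _ (p1 ∘ x) pT.
    by rewrite cmpA -q1D1 -cmpA D1x cmpm0.
  have [|y yE] := proj2 (proj2 ki) _ (a ∘ z - p2 ∘ x) pT.
    rewrite cmpBr !cmpA -bE -(cmpA b) zE cmpA -cmpBl -q2D1.
    by rewrite -cmpA D1x cmpm0.
  exists (z - d0 K ∘ y); rewrite -[RHS]cmp1m -ip [RHS]cmpDl -!cmpA -zE.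
  rewrite cmpDl -!cmpA !cmpBr (cmpA (d1 K)) d10 cmp0m cmpm0 subr0.
  by rewrite (cmpA a) ai yE cmpBr subKr.
(* Injectivity contracts the cone: [r0] retracts [D0], [r1] inverts [D1] modulo the image of [D0],
   and the idempotent [e] projects onto a complement of the image of [D1]. Splitting [e] yields
   [C]. *)
have [r0 r0E] := pj_extend (idm _) (pj_X0 K) D0m.
have [|r1 r1E] := pj_inj (u := idm Y1 - D0 ∘ r0) pY1 D01.
  by rewrite cmpBl cmp1m -cmpA r0E cmpm1 subrr.
pose e := idm Y2 - D1 ∘ r1.
have eD : e ∘ D1 = 0.
  by rewrite cmpBl -cmpA r1E cmpBr cmpA D10 cmp0m cmpm1 subr0 cmp1m subrr.
have [|C [q [s [pC sq qs]]]] := pj_split (e := e) pY2.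
  by rewrite {2}/e cmpBr cmpm1 cmpA eD cmp0m subr0.
have qD : q ∘ D1 = 0 by rewrite -[q]cmp1m -qs -(cmpA q) sq -cmpA eD cmpm0.
pose h := fmap S i ∘ d3 K ∘ q1 ∘ s.
have hq : h ∘ q = fmap S i ∘ d3 K ∘ q1.
  rewrite /h -(cmpA _ s q) sq cmpBr cmpm1 cmpA (cmp_rw _ q1D1) !cmpA.
  by rewrite (cmp_rw _ (d32 K)) cmpm0 !cmp0m subr0.
(* [D1 ∘ i1] is [j1 ∘ d2 K + j2 ∘ b] and is killed by [q], so the sign is what gives
   [g ∘ b = c ∘ d2 K]. *)
pose g := - (q ∘ j2); pose c := q ∘ j1.
have gbc : g ∘ b = c ∘ d2 K.
  apply/eqP; rewrite eq_sym -subr_eq0 cmpNm opprK -!cmpA -cmpDr.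
  have -> : j1 ∘ d2 K + j2 ∘ b = D1 ∘ i1.
    by rewrite cmpDl -!cmpA cmpBl -!cmpA p1i1 p2i1 !cmpm1 cmpm0 subr0.
  by rewrite cmpA qD cmp0m.
have hc : h ∘ c = fmap S i ∘ d3 K by rewrite cmpA hq -cmpA q1j1 cmpm1.
have fg : exact f g.
  split=> [|T x pT].
    have -> : g ∘ f = q ∘ (D1 ∘ i2).
      rewrite cmpDl -!cmpA cmpBl -!cmpA p1i2 p2i2 !cmpm1 !cmpm0 add0r sub0r.
      by rewrite !cmpmN cmpA cmpNm.
    by rewrite cmpA qD cmp0m.
  rewrite cmpNm => /eqP; rewrite oppr_eq0 => /eqP qx.
  (* That [e] kills [j2 ∘ x] exhibits it as [D1 ∘ y] with [y] the value of [r1] on it; the two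
     components of this equation are then solved in turn. *)
  have /eqP : e ∘ j2 ∘ x = 0 by rewrite -sq -!cmpA (cmpA q) qx cmpm0.
  rewrite !cmpBl cmp1m subr_eq0 -!cmpA => /eqP.
  move: (r1 ∘ _) => y yE.
  have [|z zE] := proj2 (d12 K) _ (p1 ∘ y) pT.
    by rewrite cmpA -q1D1 -cmpA -yE cmpA q1j2 cmp0m.
  exists (a ∘ z - p2 ∘ y).
  rewrite cmpBr !cmpA -bE -(cmpA b) zE cmpA -cmpBl -q2D1.
  by rewrite -cmpA -yE cmpA q2j2 cmp1m.
have Sim : mono (fmap S i).
  have [K1 [k1 kk1]] := pj_ker g pB pC.
  have [p [_ _ /(_ _ _ ki) sip]] := coimage pA fg kk1.
  by have [] := S_exact sip.
have gh : exact g h.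
  split=> [|T x pT hx].
    by rewrite cmpmN cmpA hq -cmpA q1j2 cmpm0 oppr0.
  have [|w wE] := proj2 (d23 K) _ (q1 ∘ s ∘ x) pT.
    by apply: Sim => //; rewrite !cmpA.
  exists (b ∘ w - q2 ∘ s ∘ x).
  rewrite cmpBr cmpA gbc -cmpA wE cmpNm opprK /c -!cmpA -cmpDr.
  by rewrite -[RHS]cmp1m -qs -[RHS]cmpA -[s ∘ x in RHS]cmp1m -jq cmpDl -!cmpA.
have fi' : fmap S f ∘ fmap S i = 0 by rewrite -fmapM fi fmap0.
have hf : exact h (fmap S f).
  split=> [|T x pT Sfx]; first by rewrite !cmpA fi' !cmp0m.
  have [|y <-] :=
    proj2 (exact_functor_ker S_exact pA pB pC (pj_S pA) fg gh ki) _ x pT => //.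
  have [w <-] := d3_epi y pT.
  by exists (c ∘ w); rewrite cmpA hc -cmpA.
exists C, g, h; split=> //; split=> //.
by exists K, i, a, b, c.
Qed.

(** * Four-term exact sequences and joint extension of maps *)

Section FourTerms.
Variables (K L N M : E) (m : Hom K L) (n : Hom L N) (p : Hom N M).

Definition four_exact_at (F : functor E E) : Prop :=
  [/\ mono (fmap F m), exact (fmap F m) (fmap F n), exact (fmap F n) (fmap F p)
    & epi (fmap F p)].

(** The sequence is spliced from two short exact ones at [I], and [F] preserves each. *)
Lemma exact_functor_four (F : functor E E) (I : E) (r : Hom L I)
    (j : Hom I N) : t_exact_functor pj F -> ses m r -> ses j p -> j ∘ r = n ->
  four_exact_at F.
Proof.
move=> F_exact /F_exact[mm mr re] /F_exact[jm jp pe] e.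
by rewrite /four_exact_at -e; split=> //; rewrite fmapM;
  [apply: t_exact_mono | apply: t_exact_epi].
Qed.

Hypotheses (np : exact n p) (pe : epi p).
Hypotheses (X0F : four_exact_at X0) (X1F : four_exact_at X1).
Variables (Z : E) (pZ : pj Z).

(* The next three lemmas extend maps along the total complex of the double
   complex with rows [K -> L -> N -> M] and columns [Id -> X0 -> X1]. *)
Lemma joint_extend0N (y : Hom (X0 L) Z) (z : Hom N Z) :
  y ∘ fmap X0 m = 0 -> y ∘ d0 L = z ∘ n ->
  exists w, w ∘ d0 N = z /\ w ∘ fmap X0 n = y.
Proof.
move=> ym yd; case: X0F => _ X0mn [X0pn _] _.
have [w1 w1E] := pj_inj pZ X0mn ym.
have [|x xE] := pj_inj (u := z - w1 ∘ d0 N) pZ np.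
  by rewrite cmpBl -cmpA d0N cmpA w1E yd subrr.
have [x' x'E] := pj_extend x pZ (d0_mono (M := M)).
exists (w1 + x' ∘ fmap X0 p); split; rewrite cmpDl -cmpA.
  by rewrite -d0N cmpA x'E xE addrC subrK.
by rewrite X0pn cmpm0 addr0.
Qed.

Lemma joint_extend1L (z : Hom (X0 L) Z) (y : Hom (X1 K) Z) :
  z ∘ d0 L = 0 -> z ∘ fmap X0 m = y ∘ d1 K ->
  exists w, w ∘ d1 L = z /\ w ∘ fmap X1 m = y.
Proof.
move=> zd zm; case: X0F => _ X0mn [X0pn _] _; case: X1F => X1m [X1nm _] _ _.
have [w1 w1E] := pj_extend y pZ X1m.
have [|x xE] := pj_inj (u := z - w1 ∘ d1 L) pZ X0mn.
  by rewrite cmpBl -cmpA d1N cmpA w1E zm subrr.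
(* [x] need not vanish on [d0 N], but its restriction to [N] factors through [p]. Subtracting an
   extension to X0 M cures this without changing [x ∘ fmap X0 n]. *)
have [|x1 x1E] := pj_inj (u := x ∘ d0 N) pZ np.
  by rewrite -cmpA d0N cmpA xE cmpBl zd -cmpA d10 cmpm0 subrr.
have [x2 x2E] := pj_extend x1 pZ (d0_mono (M := M)).
have [|x3 x3E] := pj_inj (u := x - x2 ∘ fmap X0 p) pZ (d01 N).
  by rewrite cmpBl -cmpA -d0N cmpA x2E x1E subrr.
exists (w1 + x3 ∘ fmap X1 n); split; rewrite cmpDl -cmpA.
  rewrite -d1N cmpA x3E cmpBl xE -cmpA X0pn cmpm0 subr0.
  by rewrite addrC subrK.
by rewrite X1nm cmpm0 addr0.
Qed.

Lemma joint_extend1N (z : Hom (X0 N) Z) (y : Hom (X1 L) Z) :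
  z ∘ d0 N = 0 -> y ∘ fmap X1 m = 0 -> y ∘ d1 L = z ∘ fmap X0 n ->
  exists w, w ∘ d1 N = z /\ w ∘ fmap X1 n = y.
Proof.
move=> zd ym yd; case: X0F => _ _ X0np _; case: X1F => _ X1mn [X1pn _] _.
have [w1 w1E] := pj_inj pZ X1mn ym.
have [|x xE] := pj_inj (u := z - w1 ∘ d1 N) pZ X0np.
  by rewrite cmpBl -cmpA d1N cmpA w1E yd subrr.
have [|x1 x1E] := pj_inj (u := x) pZ (d01 M).
  apply: (t_epiP sep pe).
  by rewrite -cmpA d0N cmpA xE cmpBl zd -cmpA d10 cmpm0 subrr cmp0m.
exists (w1 + x1 ∘ fmap X1 p); split; rewrite cmpDl -cmpA.
  by rewrite -d1N cmpA x1E xE addrC subrK.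
by rewrite X1pn cmpm0 addr0.
Qed.

End FourTerms.

(** * The octahedral axiom *)

Section Octahedron.
Variables (A B C D H G : E) (f : Hom A B) (g : Hom B C)
  (f1 : Hom B D) (f2 : Hom D (S A)) (e1 : Hom C H) (e2 : Hom H (S A))
  (g1 : Hom C G) (g2 : Hom G (S B)).
Hypotheses (pA : pj A) (pB : pj B) (pC : pj C) (pD : pj D) (pH : pj H)
  (pG : pj G).
Hypotheses (tf : p_triangle f f1 f2) (tgf : p_triangle (g ∘ f) e1 e2)
  (tg : p_triangle g g1 g2).

Section Kernels.
Variables (K L N : E) (iK : Hom K A) (iL : Hom L A) (iN : Hom N B).
Hypotheses (kK : t_kernel iK f) (kL : t_kernel iL (g ∘ f)) (kN : t_kernel iN g).

(** A map killed by [u] comes from [B], and subtracting a map through [f] moves its lift into ker g.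
    Thus ker u is the image of ker g under [f1], whichever [u] is chosen. *)
Lemma oct_ker_u (u : Hom D H) T (x : Hom T D) : pj T ->
  u ∘ f1 = e1 ∘ g -> e2 ∘ u = f2 -> u ∘ x = 0 -> exists y, f1 ∘ iN ∘ y = x.
Proof.
move=> pT uf eu ux; have [f1f _ _] := p_triangle_zero tf.
case: tf => _ [_ f12] _ _; case: tgf => [[_ gfe] _ _ _].
have [|y yE] := f12 _ x pT; first by rewrite -eu -cmpA ux cmpm0.
have [|a aE] := gfe _ (g ∘ y) pT; first by rewrite cmpA -uf -cmpA yE.
have [|w wE] := proj2 (proj2 kN) _ (y - f ∘ a) pT.
  by rewrite cmpBr cmpA aE subrr.
by exists w; rewrite -cmpA wE cmpBr cmpA f1f cmp0m subr0.
Qed.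

Lemma oct_kernels : exists (m : Hom K L) (n : Hom L N) (M : E)
    (iM : Hom M D) (p : Hom N M) (I : E) (r : Hom L I) (j : Hom I N),
  [/\ [/\ iL ∘ m = iK, iN ∘ n = f ∘ iL & iM ∘ p = f1 ∘ iN],
      mono iM, exact n p, epi p & [/\ ses m r, ses j p & j ∘ r = n]].
Proof.
have [f1f f21 Sff] := p_triangle_zero tf.
have [g1g _ _] := p_triangle_zero tg.
have [e1g _ _] := p_triangle_zero tgf.
case: (kK) (kL) (kN) => iKm [fiK iKf] [iLm [gfiL iLf]] [iNm [giN iNg]].
case: tf => [[_ ff1] _ _ _].
have [m mE] : exists m, iL ∘ m = iK.
  by apply: ker_lift iLm (proj2 kL) _; rewrite -cmpA fiK cmpm0.
have [n nE] : exists n, iN ∘ n = f ∘ iL.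
  by apply: ker_lift iNm (proj2 kN) _; rewrite cmpA.
have [u [uf ue]] : exists u, u ∘ f1 = e1 ∘ g /\ fmap S (idm A) ∘ f2 = e2 ∘ u.
  by apply: p_triangle_mor tf tgf _; rewrite ?cmpm1.
rewrite fmap1 cmp1m in ue.
have [M [iM [iMm kM]]] := pj_ker u pD pH.
have [p pE] : exists p, iM ∘ p = f1 ∘ iN.
  by apply: ker_lift iMm kM _; rewrite cmpA uf -cmpA giN cmpm0.
have pe : epi p.
  move=> T x pT.
  have [|y yE] := oct_ker_u (u := u) (x := iM ∘ x) pT uf (esym ue).
    by case: kM => uM _; rewrite cmpA uM cmp0m.
  by exists y; apply: (t_monoP sep iMm); rewrite cmpA pE.
have pn : p ∘ n = 0.
  by apply: (t_monoP sep iMm); rewrite cmpA pE -cmpA nE cmpA f1f cmp0m cmpm0.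
have lift_n T (y : Hom T N) : pj T -> f1 ∘ iN ∘ y = 0 -> exists l, n ∘ l = y.
  move=> pT; rewrite -cmpA => /(ff1 _ _ pT) [a aE].
  have [|l lE] := iLf _ a pT; first by rewrite -cmpA aE cmpA giN cmp0m.
  by exists l; apply: (t_monoP sep iNm); rewrite cmpA nE -cmpA lE.
have np : exact n p.
  split=> // T y pT py; apply: lift_n => //.
  by rewrite -pE -cmpA py cmpm0.
(* The splice object [I] is the intersection of im f and ker g, realised as the kernel of the map
   (f1, g) from B to D ⊕ C because kernels are available only between objects of [pj]. *)
have [Y [k1 [k2 [q1 [q2 [pY [q1k1 q2k2 q1k2 q2k1 _]]]]]]] := pj_biprod pD pC.
have [I [i [im [qi iq]]]] := pj_ker (k1 ∘ f1 + k2 ∘ g) pB pY.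
have f1i : f1 ∘ i = 0.
  have : q1 ∘ ((k1 ∘ f1 + k2 ∘ g) ∘ i) = 0 by rewrite qi cmpm0.
  by rewrite cmpDl cmpDr !cmpA q1k1 q1k2 cmp1m !cmp0m addr0.
have gi : g ∘ i = 0.
  have : q2 ∘ ((k1 ∘ f1 + k2 ∘ g) ∘ i) = 0 by rewrite qi cmpm0.
  by rewrite cmpDl cmpDr !cmpA q2k1 q2k2 cmp1m !cmp0m add0r.
have [r rE] : exists r, i ∘ r = f ∘ iL.
  apply: ker_lift im (conj qi iq) _.
  by rewrite cmpDl -!cmpA (cmpA f1) f1f (cmpA g f) gfiL cmp0m !cmpm0 addr0.
have [j jE] : exists j, iN ∘ j = i by apply: ker_lift iNm (proj2 kN) _.
have jr : j ∘ r = n by apply: (t_monoP sep iNm); rewrite cmpA jE rE nE.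
have mm : mono m.
  by move=> T x pT mx; apply: (iKm) => //; rewrite -mE -cmpA mx cmpm0.
have jm : mono j.
  by move=> T x pT jx; apply: (im) => //; rewrite -jE -cmpA jx cmpm0.
exists m, n, M, iM, p, I, r, j; split=> //; split=> //; split=> //.
- split=> [|T x pT rx].
    by apply: (t_monoP sep im); rewrite cmpA rE -cmpA mE fiK cmpm0.
  have [|y yE] := iKf _ (iL ∘ x) pT; first by rewrite cmpA -rE -cmpA rx cmpm0.
  by exists y; apply: (t_monoP sep iLm); rewrite cmpA mE.
- move=> T x pT; have [|l lE] := lift_n _ (j ∘ x) pT.
    by rewrite cmpA (cmp_rw _ jE) f1i cmp0m.
  by exists l; apply: (t_monoP sep jm); rewrite cmpA jr.
- split=> [|T x pT px].
    by apply: (t_monoP sep iMm); rewrite cmpA pE -cmpA jE f1i cmpm0.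
  have [_ /(_ _ _ pT px) [l <-]] := np.
  by exists (r ∘ l); rewrite cmpA jr.
Qed.

End Kernels.

Lemma oct_exact (u : Hom D H) (v : Hom H G) :
  u ∘ f1 = e1 ∘ g -> e2 ∘ u = f2 -> v ∘ e1 = g1 -> g2 ∘ v = fmap S f ∘ e2 ->
  v ∘ u = 0 ->
  [/\ exact u v, exact v (fmap S f1 ∘ g2)
    & exact (fmap S f1 ∘ g2) (fmap S u)].
Proof.
move=> uf eu ve gv vu.
have [f1f f21 Sf2] := p_triangle_zero tf.
have [g1g g21 Sg2] := p_triangle_zero tg.
have [e1g e21 Se2] := p_triangle_zero tgf.
have [Sf1f Sff1] := p_triangle_S pA pB pD tf.
have [Sg1g Sgg1] := p_triangle_S pB pC pG tg.
have [Se1g Sge1] := p_triangle_S pA pC pH tgf.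
case: (tf) (tg) (tgf) => [[_ ff1] [_ f12] [_ f2f] _].
move=> [[_ gg1] [_ g12] [_ g2g] _] [[_ ge1] [_ e12] [_ e2g] _].
split; split=> //.
- move=> T x pT vx; have [|y yE] := f2f _ (e2 ∘ x) pT.
    by rewrite cmpA -gv -cmpA vx cmpm0.
  have [|c cE] := e12 _ (x - u ∘ y) pT; first by rewrite cmpBr cmpA eu yE subrr.
  have [|b bE] := gg1 _ c pT.
    by rewrite -ve -cmpA cE cmpBr vx cmpA vu cmp0m subrr.
  exists (y + f1 ∘ b); rewrite cmpDr cmpA uf -cmpA bE cE.
  by rewrite addrC subrK.
- by rewrite -cmpA gv cmpA Sf1f cmp0m.
- move=> T x pT; rewrite -cmpA => Sfg.
  have [a aE] := Sff1 _ _ pT Sfg.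
  have [|y yE] := e2g _ a pT; first by rewrite fmapM -cmpA aE cmpA Sg2 cmp0m.
  have [|c cE] := g12 _ (x - v ∘ y) pT.
    by rewrite cmpBr cmpA gv -cmpA yE aE subrr.
  by exists (y + e1 ∘ c); rewrite cmpDr cmpA ve cE addrC subrK.
- by rewrite cmpA -fmapM uf fmapM -cmpA Sg2 cmpm0.
(* For exactness at S D, the rotated triangle supplies exactness of [fmap S f1], [fmap S f2]. *)
move=> T x pT Sux.
have [Sf21 Sf12] :=
  p_triangle_S pB pD (pj_S pA) (p_triangle_rot pA pB pD tf).
have [|b bE] := Sf12 _ x pT.
  by rewrite -eu fmapM -cmpA Sux cmpm0.
have [|a aE] := Sge1 _ (fmap S g ∘ b) pT.
  by rewrite cmpA -fmapM -uf fmapM -cmpA bE.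
have [|y yE] := g2g _ (b - fmap S f ∘ a) pT.
  by rewrite cmpBr cmpA -fmapM aE subrr.
by exists y; rewrite -cmpA yE cmpBr cmpA Sf1f cmp0m subr0.
Qed.

Lemma p_triangle_oct : exists (u : Hom D H) (v : Hom H G),
  [/\ p_triangle u v (fmap S f1 ∘ g2), u ∘ f1 = e1 ∘ g, e2 ∘ u = f2,
      v ∘ e1 = g1 & g2 ∘ v = fmap S f ∘ e2].
Proof.
have [f1f f21 Sf2] := p_triangle_zero tf.
have [g1g g21 Sg2] := p_triangle_zero tg.
have [e1g e21 Se2] := p_triangle_zero tgf.
have [K [iK kK]] := pj_ker f pA pB.
have [L [iL kL]] := pj_ker (g ∘ f) pA pC.
have [N [iN kN]] := pj_ker g pB pC.
have [m [n [M [iM [p [I [r [j [[iLm iNn iMp] iMm np pe [mr jp jr]]]]]]]]]] :=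
  oct_kernels kK kL kN.
have X0F := exact_functor_four X0_exact mr jp jr.
have X1F := exact_functor_four X1_exact mr jp jr.
have X2F := exact_functor_four X2_exact mr jp jr.
case: (X0F) (X1F) (X2F) => X0m [X0nm X0mn] [X0pn X0np] X0p.
move=> [X1m [X1nm X1mn] [X1pn X1np] X1p] [X2m [X2nm X2mn] [X2pn X2np] X2p].
have [fiK gfiL giN] : [/\ f ∘ iK = 0, g ∘ f ∘ iL = 0 & g ∘ iN = 0].
  by case: kK kL kN => [_ []] ? _ [_ []] ? _ [_ []].
have [aL aLd] := pj_extend iL pA (d0_mono (M := L)).
pose aK := aL ∘ fmap X0 m.
have aKd : aK ∘ d0 K = iK by rewrite -cmpA -d0N cmpA aLd.
have [|bK bKd] := pj_inj (u := f ∘ aK) pB (d01 K); first by rewrite -cmpA aKd.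
(* Strict compatibility of [aL] with [aN] cannot be asked for. [s1] serves as a homotopy: extending
   [bK], it makes [f ∘ aL - s1 ∘ d1 L] vanish on X0 K, and the same [s1] enters the choice of
   [bN]. *)
have [s1 s1m] := pj_extend bK pB X1m.
have [||aN [aNd aNn]] := joint_extend0N np X0F pB
    (y := f ∘ aL - s1 ∘ d1 L) (z := iN).
- by rewrite cmpBl -!cmpA d1N (cmpA s1) s1m bKd subrr.
- by rewrite cmpBl -!cmpA d10 aLd iNn cmpm0 subr0.
have [||bL [bLd bLm]] := joint_extend1L np X0F X1F pC
    (z := g ∘ f ∘ aL) (y := g ∘ bK).
- by rewrite -cmpA aLd.
- by rewrite -!cmpA bKd.
have [|||bN [bNd bNn]] := joint_extend1N pe X0F X1F pC
    (z := g ∘ aN) (y := bL - g ∘ s1).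
- by rewrite -cmpA aNd.
- by rewrite cmpBl bLm -cmpA s1m subrr.
- by rewrite cmpBl bLd -!cmpA aNn cmpBr.
have [cK cmpK] := compares_extend pA pB tf kK aKd (esym bKd).
have [cL cmpL] := compares_extend pA pC tgf kL aLd (esym bLd).
have [cN cmpN] := compares_extend pB pC tg kN aNd (esym bNd).
case: (cmpK) (cmpL) (cmpN) => [_ _ fbK f2c] [_ _ ebL e2c] [_ _ gbN g2c].
have [||u [uf uc]] := compares_desc pA pB pD tf kK cmpK
    (y := cL ∘ fmap X2 m) (z := e1 ∘ g) pH.
- by rewrite -cmpA.
- by rewrite -!cmpA -d2N (cmpA cL) -ebL -cmpA bLm.
have [||v [ve vc]] := compares_desc pA pC pH tgf kL cmpL
    (y := cN ∘ fmap X2 n) (z := g1) pG.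
- by rewrite cmpA g1g cmp0m.
- by rewrite -!cmpA -d2N (cmpA cN) -gbN -cmpA bNn cmpBr cmpA g1g cmp0m subr0.
(* This equation and the two after it are tested on the jointly epic pairs [f1], [cK] and [e1],
   [cL]. *)
have vu : v ∘ u = 0.
  apply: (compares_ext pA pB pD tf kK cmpK); rewrite cmp0m -!cmpA.
    by rewrite uf cmpA ve g1g.
  by rewrite uc cmpA vc -cmpA X2nm cmpm0.
have eu : e2 ∘ u = f2.
  apply: (compares_ext pA pB pD tf kK cmpK); rewrite -!cmpA.
    by rewrite uf f21 cmpA e21 cmp0m.
  by rewrite uc cmpA e2c f2c -cmpA d3N cmpA -fmapM iLm.
have gv : g2 ∘ v = fmap S f ∘ e2.
  apply: (compares_ext pA pC pH tgf kL cmpL); rewrite -!cmpA.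
    by rewrite ve g21 e21 cmpm0.
  by rewrite vc e2c !cmpA g2c -cmpA d3N cmpA -!fmapM iNn.
exists u, v; split=> //.
have [uv vw wu] := oct_exact uf eu ve gv vu.
split=> //.
(* For the comparison out of X M, the maps [f1 ∘ aN], [e1 ∘ bN] and [cN] on X N are corrected by [t]
   and [t'] until they vanish on X L, and then descend along X N -> X M. *)
have [s2 s2m] := pj_extend cK pD X2m.
have [|t tE] := pj_inj (u := f1 ∘ s1 - s2 ∘ d2 L) pD (conj X1nm X1mn).
  by rewrite cmpBl -!cmpA s1m d2N (cmpA s2) s2m fbK subrr.
have [|a aE] := pj_inj (u := f1 ∘ aN + t ∘ d1 N) pD (conj X0pn X0np).
  rewrite cmpDl -!cmpA aNn d1N (cmpA t) tE cmpBr cmpBl -!cmpA d21 cmpm0 subr0.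
  by rewrite (cmpA f1 f) f1f cmp0m sub0r addNr.
have [|t' t'E] := pj_inj (u := cL - u ∘ s2) pH (conj X2nm X2mn).
  by rewrite cmpBl -!cmpA s2m uc subrr.
have [|b bE] := pj_inj (u := e1 ∘ bN + u ∘ t - t' ∘ d2 N) pH (conj X1pn X1np).
  rewrite cmpBl cmpDl -!cmpA bNn tE d2N (cmpA t') t'E cmpBl !cmpBr !cmpA ebL uf.
  by rewrite addrA subrK subrr.
have [|c cE] := pj_inj (u := cN - v ∘ t') pG (conj X2pn X2np).
  by rewrite cmpBl -!cmpA t'E cmpBr cmpA vc vu cmp0m subr0 subrr.
exists M, iM, a, b, c; split; split=> //.
(* [M] was built as the kernel of an auxiliary map D -> H; by [oct_ker_u] it is a kernel of the
   present [u] as well. *)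
- split=> [|T x pT ux].
    apply: (t_epiP sep pe); rewrite -cmpA iMp cmpA uf -cmpA giN.
    by rewrite cmpm0 cmp0m.
  have [y <-] := oct_ker_u kN pT uf eu ux.
  by exists (p ∘ y); rewrite cmpA iMp.
- apply: (t_epiP sep pe).
  by rewrite -cmpA d0N cmpA aE cmpDl -!cmpA d10 aNd cmpm0 addr0.
- apply: (t_epiP sep X0p).
  rewrite -!cmpA d1N aE (cmpA b) bE cmpBl -(cmpA t') d21 cmpm0 subr0.
  by rewrite cmpDr cmpDl -!cmpA bNd (cmpA u) uf !cmpA.
- apply: (t_epiP sep X1p).
  rewrite -!cmpA d2N bE (cmpA c) cE cmpBr cmpDr !cmpBl !cmpA ve vu cmp0m addr0.
  by rewrite gbN.
apply: (t_epiP sep X2p).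
rewrite -!cmpA d3N cE !cmpBr !cmpA -(cmpA _ g2 cN) g2c -(cmpA _ g2 v) gv.
by rewrite !cmpA -!fmapM f1f fmap0 !cmp0m subr0 iMp.
Qed.

End Octahedron.

(** A five lemma by diagram chase; the inverse is a lift of [idm C'] along [w], since [C'] is itself
    a test object. *)
Lemma p_triangle_five (A B C C' : E) (f : Hom A B) (g : Hom B C)
    (h : Hom C (S A)) (g' : Hom B C') (h' : Hom C' (S A)) (w : Hom C C') :
  pj C -> pj C' -> p_triangle f g h -> p_triangle f g' h' ->
  w ∘ g = g' -> h' ∘ w = h -> is_iso w.
Proof.
move=> pC pC' dt dt' wg hw.
have [gf _ Sfh] := p_triangle_zero dt; have [_ hg' Sfh'] := p_triangle_zero dt'.
case: dt dt' => _ [_ gh] [_ hf] _ [[_ fg'] [_ gh'] _ _].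
have wm : mono w.
  move=> T x pT wx; have [|b bE] := gh _ x pT.
    by rewrite -hw -cmpA wx cmpm0.
  have [|a aE] := fg' _ b pT; first by rewrite -wg -cmpA bE.
  by rewrite -bE -aE cmpA gf cmp0m.
have we : epi w.
  move=> T x pT; have [|y yE] := hf _ (h' ∘ x) pT.
    by rewrite cmpA Sfh' cmp0m.
  have [|b bE] := gh' _ (x - w ∘ y) pT; first by rewrite cmpBr cmpA hw yE subrr.
  by exists (y + g ∘ b); rewrite cmpDr cmpA wg bE addrC subrK.
have [y wy] := we _ (idm C') pC'; exists y; split=> //.
by apply: (t_monoP sep wm); rewrite cmpA wy cmp1m cmpm1.
Qed.

(** * Transport of the triangles along a fully faithful functor with essential image [pj] *)

Section Transfer.
Variables (T : precat) (Y : functor T E) (ST : functor T T).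
Hypothesis T_additive : is_additive T.
Hypothesis ST_auto : is_autoequivalence ST.
Hypothesis pj_Y : forall A, pj (Y A).
Hypothesis pj_ess : forall M, pj M -> exists A, isomorphic M (Y A).
Hypothesis Y_full : forall A B (u : Hom (Y A) (Y B)), exists f, fmap Y f = u.
Hypothesis Y_faithful :
  forall A B (f g : Hom A B), fmap Y f = fmap Y g -> f = g.
Variables (t : forall A, Hom (S (Y A)) (Y (ST A)))
  (t' : forall A, Hom (Y (ST A)) (S (Y A))).
Hypotheses (tt' : forall A, t A ∘ t' A = idm _)
  (t't : forall A, t' A ∘ t A = idm _).
Hypothesis tN : forall A B (f : Hom A B),
  t B ∘ fmap S (fmap Y f) = fmap Y (fmap ST f) ∘ t A.

(** S (Y A) and Y (ST A) are merely isomorphic, so [t' A] corrects the target of the third map. *)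
Definition triangle (A B C : T) (f : Hom A B) (g : Hom B C)
    (h : Hom C (ST A)) : Prop :=
  p_triangle (fmap Y f) (fmap Y g) (t' A ∘ fmap Y h).

Lemma t'N A B (f : Hom A B) :
  fmap S (fmap Y f) ∘ t' A = t' B ∘ fmap Y (fmap ST f).
Proof.
rewrite -[LHS]cmp1m -(t't B) -(cmpA (t' B)) (cmpA (t B)) tN.
by rewrite -(cmpA _ (t A)) tt' cmpm1.
Qed.

Lemma t_inj A (M : E) (u v : Hom M (Y (ST A))) : t' A ∘ u = t' A ∘ v -> u = v.
Proof. by move=> e; rewrite -[u]cmp1m -[v]cmp1m -tt' -!cmpA e. Qed.

Lemma Y_reflect_iso A B (f : Hom A B) : is_iso (fmap Y f) -> is_iso f.
Proof.
move=> [u]; have [g <-] := Y_full u; rewrite -!fmapM => -[gf fg].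
by exists g; split; apply: Y_faithful; rewrite fmap1.
Qed.

Lemma triangle_iso (A B C A' B' C' : T)
    (f : Hom A B) (g : Hom B C) (h : Hom C (ST A))
    (f' : Hom A' B') (g' : Hom B' C') (h' : Hom C' (ST A'))
    (a : Hom A A') (b : Hom B B') (c : Hom C C') :
  is_iso a -> is_iso b -> is_iso c ->
  b ∘ f = f' ∘ a -> c ∘ g = g' ∘ b -> fmap ST a ∘ h = h' ∘ c ->
  triangle f g h -> triangle f' g' h'.
Proof.
move=> ia ib ic ef eg eh.
apply: p_triangle_iso (fmap_iso Y ia) (fmap_iso Y ib) (fmap_iso Y ic) _ _ _.
- by rewrite -!fmapM ef.
- by rewrite -!fmapM eg.
by rewrite cmpA t'N -!cmpA -!fmapM eh.
Qed.

Lemma triangle_cone (A B : T) (f : Hom A B) :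
  exists (C : T) (g : Hom B C) (h : Hom C (ST A)), triangle f g h.
Proof.
have [C0 [g0 [h0 [pC dt]]]] := p_triangle_cone (fmap Y f) (pj_Y A) (pj_Y B).
have [C [p ip]] := pj_ess pC; have [q [qp pq]] := ip.
have [g gE] := Y_full (p ∘ g0); have [h hE] := Y_full (t A ∘ h0 ∘ q).
exists C, g, h; apply: p_triangle_iso (is_iso_idm _) (is_iso_idm _) ip _ _ _ dt.
- by rewrite cmp1m cmpm1.
- by rewrite gE cmpm1.
by rewrite hE fmap1 cmp1m !cmpA t't cmp1m -cmpA qp cmpm1.
Qed.

Lemma triangle_mor (A B C A' B' C' : T)
    (f : Hom A B) (g : Hom B C) (h : Hom C (ST A))
    (f' : Hom A' B') (g' : Hom B' C') (h' : Hom C' (ST A'))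
    (a : Hom A A') (b : Hom B B') :
  triangle f g h -> triangle f' g' h' -> b ∘ f = f' ∘ a ->
  exists c : Hom C C', c ∘ g = g' ∘ b /\ fmap ST a ∘ h = h' ∘ c.
Proof.
move=> dt dt' e.
have [|w [wg wh]] := p_triangle_mor (pj_Y _) (pj_Y _) (pj_Y _) (pj_Y _) (pj_Y _)
    (pj_Y _) dt dt' (u := fmap Y a) (v := fmap Y b).
  by rewrite -!fmapM e.
have [c cE] := Y_full w; exists c; split; apply: Y_faithful.
  by rewrite !fmapM cE wg.
by rewrite !fmapM; apply: t_inj; rewrite cmpA -t'N -cmpA wh cE cmpA.
Qed.

Lemma triangle_rot (A B C : T) (f : Hom A B) (g : Hom B C)
  (h : Hom C (ST A)) : triangle f g h -> triangle g h (- fmap ST f).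
Proof.
move=> /(p_triangle_rot (pj_Y _) (pj_Y _) (pj_Y _)).
have it : is_iso (t A) by exists (t' A).
apply: p_triangle_iso (is_iso_idm _) (is_iso_idm _) it _ _ _.
- by rewrite cmp1m cmpm1.
- by rewrite cmpA tt' cmp1m cmpm1.
rewrite fmap1 cmp1m fmapN cmpmN cmpNm -t'N -cmpA t't cmpm1.
by [].
Qed.

(* Rotating three times more compares [(f, g, h)], after [ST], with a triangle
   on [f]; [ST] is fully faithful. *)
Lemma triangle_rot_inv (A B C : T) (f : Hom A B) (g : Hom B C)
  (h : Hom C (ST A)) : triangle g h (- fmap ST f) -> triangle f g h.
Proof.
move=> dt; have [C' [g' [h' dt']]] := triangle_cone f.
(* After these rotations both triangles begin with [- fmap ST f], so the identities extend to a
   morphism between them. *)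
have := triangle_rot (triangle_rot dt); set dt3 := triangle _ _ _ => d3t.
have := triangle_rot (triangle_rot (triangle_rot dt')).
set dt3' := triangle _ _ _ => d3t'.
have [|w [wg wh]] := triangle_mor d3t' d3t (a := idm _) (b := idm _).
  by rewrite cmp1m cmpm1.
have iw : is_iso w.
  apply: Y_reflect_iso.
  apply: p_triangle_five (pj_Y _) (pj_Y _) d3t' d3t _ _.
    by rewrite -fmapM wg cmpm1.
  by rewrite -cmpA -fmapM -wh fmap1 cmp1m.
have [c cE] := autoequivalence_full w ST_auto.
have ic : is_iso c.
  have [v [vw wv]] := iw; have [d dE] := autoequivalence_full v ST_auto.
  by exists d; split; apply: (autoequivalence_faithful ST_auto);
    rewrite fmapM cE dE fmap1.
apply: triangle_iso (is_iso_idm _) (is_iso_idm _) ic _ _ _ dt'.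
- by rewrite cmp1m cmpm1.
- apply: (autoequivalence_faithful ST_auto); rewrite cmpm1 fmapM cE.
  by apply: oppr_inj; rewrite -cmpmN wg cmpm1.
rewrite fmap1 cmp1m; apply: (autoequivalence_faithful ST_auto).
by apply: oppr_inj; rewrite fmapM cE -cmpNm -wh fmap1 cmp1m.
Qed.

Lemma triangulated_transfer : has_triangulated_structure ST.
Proof.
exists triangle; split=> //.
- exact: triangle_iso.
- move=> A Z Z0; rewrite /triangle fmap1 !fmap0 cmpm0.
  by apply: p_triangle_id => //; rewrite /is_zero -fmap1 Z0 fmap0.
- exact: triangle_cone.
- by move=> A B C f g h; split; [apply: triangle_rot | apply: triangle_rot_inv].
- exact: triangle_mor.
move=> A B C D H G f g f1 f2 e1 e2 g1 g2 tf tgf tg.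
rewrite /triangle fmapM in tgf.
have [u0 [v0 [uv uf eu ve gv]]] := p_triangle_oct (pj_Y _) (pj_Y _) (pj_Y _)
  (pj_Y _) (pj_Y _) (pj_Y _) tf tgf tg.
have [u uE] := Y_full u0; have [v vE] := Y_full v0.
exists u, v; split; first by rewrite /triangle uE vE fmapM cmpA -t'N -cmpA.
- by apply: Y_faithful; rewrite !fmapM uE.
- by apply: Y_faithful; apply: t_inj; rewrite !fmapM uE cmpA.
- by apply: Y_faithful; rewrite !fmapM vE.
by apply: Y_faithful; apply: t_inj; rewrite !fmapM vE !cmpA gv -t'N -cmpA.
Qed.

End Transfer.

End ProjectiveTriangles.

(** * Functors with finite-dimensional values *)

Section Functors.
Variables (k : fieldType) (P : klincat k).

Section Pointwise.
Variables L M N : cfun P.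

Lemma cnat_natE (s : cnat M N) A B (f : kHom A B) x :
  s A (cmap M f x) = cmap N f (s B x).
Proof. by rewrite -!comp_lfunE cncP. Qed.

Lemma cnat_compE (t : cnat M N) (s : cnat L M) A x :
  cnat_comp t s A x = t A (s A x).
Proof. exact: comp_lfunE. Qed.

Lemma cnatP (s t : cnat M N) : (forall A x, s A x = t A x) -> s = t.
Proof. by move=> st; apply: cnat_eq => A; apply/lfunP => x. Qed.

Lemma pmonoP (s : cnat M N) : pmono s <-> forall A x, s A x = 0 -> x = 0.
Proof.
split=> sm A.
  move=> x sx; apply/eqP; rewrite -memv0 -(sm A) memv_ker; exact/eqP.
apply/eqP; rewrite -subv0; apply/subvP => x.
by rewrite memv_ker memv0 => /eqP /sm ->.
Qed.

Lemma pepiP (s : cnat M N) : pepi s <-> forall A y, exists x, s A x = y.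
Proof.
split=> se A.
  move=> y; have := memvf y.
  by rewrite -(se A) => /memv_imgP [x _ ->]; exists x.
apply/vspaceP => y; rewrite memvf.
by have [x <-] := se A y; apply/memv_img/memvf.
Qed.

Lemma exact_atP (s : cnat L M) (t : cnat M N) : exact_at s t <->
  (forall A x, t A (s A x) = 0) /\
  (forall A y, t A y = 0 -> exists x, s A x = y).
Proof.
split=> [st|[ts st] A].
  split=> A x.
    by apply/eqP; rewrite -memv_ker -st; apply/memv_img/memvf.
  by move/eqP; rewrite -memv_ker -st => /memv_imgP [y _ ->]; exists y.
apply/eqP; rewrite eqEsubv; apply/andP; split; apply/subvP => y.
  by move=> /memv_imgP [x _ ->]; rewrite memv_ker ts.
by rewrite memv_ker => /eqP /st [x <-]; apply/memv_img/memvf.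
Qed.

End Pointwise.

Lemma lfun_invK (U V : vectType k) (f : 'Hom(U, V)) x :
  f ((f^-1)%VF (f x)) = f x.
Proof. by apply: limg_lfunVK; apply/memv_img/memvf. Qed.

(** Pointwise pseudo-inverses of [t] need not be natural, but their ambiguity lies in ker t = im s,
    which [u] kills. *)
Lemma cnat_desc (L M N Z : cfun P) (s : cnat L M) (t : cnat M N)
    (u : cnat M Z) : exact_at s t -> pepi t ->
  (forall A x, u A (s A x) = 0) -> exists v : cnat N Z, cnat_comp v t = u.
Proof.
move=> /exact_atP [ts st] /pepiP te us.
pose w A := (u A \o (t A)^-1)%VF.
have wt A x : w A (t A x) = u A x.
  apply/eqP; rewrite comp_lfunE -subr_eq0 -linearB; apply/eqP.
  have [|y <-] := st A ((t A)^-1%VF (t A x) - x); last exact: us.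
  by rewrite linearB /= lfun_invK subrr.
have wN A B (f : kHom A B) : (w A \o cmap N f = cmap Z f \o w B)%VF.
  apply/lfunP => y; have [x <-] := te B y.
  by rewrite [LHS]comp_lfunE [RHS]comp_lfunE -cnat_natE !wt cnat_natE.
by exists (Cnat wN); apply: cnatP => A x; rewrite cnat_compE.
Qed.

(** Here injectivity of [s] forces the pointwise lifts to be natural. *)
Lemma cnat_lift (L M N Z : cfun P) (s : cnat L M) (t : cnat M N)
    (x : cnat Z M) : pmono s -> exact_at s t ->
  (forall A z, t A (x A z) = 0) -> exists y : cnat Z L, cnat_comp s y = x.
Proof.
move=> /pmonoP sm /exact_atP [_ st] tx.
pose w A := ((s A)^-1 \o x A)%VF.
have sw A z : s A (w A z) = x A z.
  by have [y yE] := st A _ (tx A z); rewrite comp_lfunE -yE lfun_invK.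
have wN A B (f : kHom A B) : (w A \o cmap Z f = cmap L f \o w B)%VF.
  apply/lfunP => z; apply/eqP; rewrite -subr_eq0; apply/eqP; apply: sm.
  rewrite linearB /= [X in s A X - _]comp_lfunE [X in _ - s A X]comp_lfunE.
  by rewrite sw !cnat_natE sw subrr.
by exists (Cnat wN); apply: cnatP => A z; rewrite cnat_compE.
Qed.

(** * Pointwise cokernels *)

Section Quotient.
Variables (M N : cfun P) (s : cnat M N).

Let U A := limg (s A).
Let W A := (U A)^C%VS.
(** The quotient by the image is modelled on a complement, and the quotient map is the projection
    along the image. *)
Definition quot_ob (A : kob P) : vectType k := subvs_of (W A).
Definition quot_lfun A : 'Hom(N A, quot_ob A) :=
  (linfun (vsproj (W A)) \o daddv_pi (W A) (U A))%VF.

Fact quot_capv A : (W A :&: U A = 0)%VS.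
Proof. by rewrite capvC capv_compl. Qed.

Lemma quot_lfun_epi A y : exists x, quot_lfun A x = y.
Proof.
exists (vsval y).
by rewrite comp_lfunE lfunE /= daddv_pi_id ?subvsP ?quot_capv // vsvalK.
Qed.

Lemma quot_lfun_eq0 A x : quot_lfun A x = 0 <-> exists z, s A z = x.
Proof.
rewrite comp_lfunE lfunE /=; split=> [qx|[z <-]].
  have dx : daddv_pi (W A) (U A) x = 0.
    by rewrite -[LHS](@vsprojK _ _ (W A)) ?memv_pi // qx linear0.
  have xWU : x \in (W A + U A)%VS by rewrite addvC addv_complf memvf.
  have := daddv_pi_add (quot_capv A) xWU; rewrite dx add0r => xU.
  have : x \in U A by rewrite -xU memv_pi.
  by move=> /memv_imgP [z _ ->]; exists z.
suff -> : daddv_pi (W A) (U A) (s A z) = 0 by rewrite linear0.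
have sU : s A z \in U A by apply/memv_img/memvf.
have xWU : s A z \in (W A + U A)%VS by rewrite addvC addv_complf memvf.
have := daddv_pi_add (quot_capv A) xWU; rewrite (daddv_pi_id _ sU); last first.
  by rewrite capvC quot_capv.
by move/(canRL (addrK _)); rewrite subrr.
Qed.

Local Notation q := quot_lfun.

Definition quot_map A B (f : kHom A B) : 'Hom(quot_ob B, quot_ob A) :=
  (q A \o cmap N f \o (q B)^-1)%VF.

Lemma quot_mapE A B (f : kHom A B) x : quot_map f (q B x) = q A (cmap N f x).
Proof.
apply/eqP; rewrite 2!comp_lfunE -subr_eq0 -!linearB; apply/eqP.
apply/quot_lfun_eq0.
have [|z zE] := (quot_lfun_eq0 ((q B)^-1%VF (q B x) - x)).1.
  by rewrite linearB /= lfun_invK subrr.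
by exists (cmap M f z); rewrite cnat_natE zE.
Qed.

Fact quot_map1 A : quot_map (kid A) = \1%VF.
Proof.
apply/lfunP => y; have [x <-] := quot_lfun_epi y.
by rewrite quot_mapE cmap1 !id_lfunE.
Qed.

Fact quot_mapM A B C (g : kHom B C) (f : kHom A B) :
  quot_map (kcmp g f) = (quot_map f \o quot_map g)%VF.
Proof.
apply/lfunP => y; have [x <-] := quot_lfun_epi y.
by rewrite [RHS]comp_lfunE !quot_mapE cmapM comp_lfunE.
Qed.

Fact quot_mapP A B (a : k) (f g : kHom A B) :
  quot_map (a *: f + g) = a *: quot_map f + quot_map g.
Proof.
apply/lfunP => y; have [x <-] := quot_lfun_epi y.
rewrite add_lfunE scale_lfunE !quot_mapE cmapP add_lfunE scale_lfunE.
by rewrite linearP.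
Qed.

Definition quot : cfun P := Cfun quot_map1 quot_mapM quot_mapP.

Fact quot_projP A B (f : kHom A B) : (q A \o cmap N f = cmap quot f \o q B)%VF.
Proof.
by apply/lfunP => x; rewrite [LHS]comp_lfunE [RHS]comp_lfunE /= quot_mapE.
Qed.
Definition quot_proj : cnat N quot := @Cnat k P N quot q quot_projP.

Lemma quot_proj_exact : exact_at s quot_proj.
Proof.
by apply/exact_atP; split=> A x; rewrite /= quot_lfun_eq0 //; exists x.
Qed.

Lemma quot_proj_epi : pepi quot_proj.
Proof. by apply/pepiP => A y; apply: quot_lfun_epi. Qed.

End Quotient.

(** * The Yoneda lemma and presentations of cokernels *)

Section YonedaLemma.
Variables (A : kob P) (M : cfun P) (x : M A).

Definition yo_fun (X : kob P) (g : kHom X A) : M X := cmap M g x.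

Fact yo_fun_linear X : linear (@yo_fun X).
Proof. by move=> a g h; rewrite /yo_fun cmapP add_lfunE scale_lfunE. Qed.

HB.instance Definition _ X :=
  GRing.isLinear.Build k (kHom X A) (M X) _ (@yo_fun X) (@yo_fun_linear X).

Fact yo_natP X Y (f : kHom X Y) :
  (linfun (@yo_fun X) \o cmap (rep A) f = cmap M f \o linfun (@yo_fun Y))%VF.
Proof.
apply/lfunP => g; rewrite [LHS]comp_lfunE [RHS]comp_lfunE !lfunE /=.
by rewrite /yo_fun /precomp cmapM comp_lfunE.
Qed.

Definition yo_nat : cnat (rep A) M := Cnat yo_natP.

Lemma yo_natE X (g : kHom X A) : yo_nat X g = cmap M g x.
Proof. by rewrite lfunE. Qed.

Lemma yo_nat_kid : yo_nat A (kid A) = x.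
Proof. by rewrite yo_natE cmap1 id_lfunE. Qed.

End YonedaLemma.

Lemma rep_cnatE (A : kob P) (M : cfun P) (s : cnat (rep A) M) X
    (g : kHom X A) : s X g = cmap M g (s A (kid A)).
Proof. by rewrite -cnat_natE /= rep_mapE kcmp1m. Qed.

Lemma rep_cnatP (A : kob P) (M : cfun P) (s t : cnat (rep A) M) :
  s A (kid A) = t A (kid A) -> s = t.
Proof. by move=> e; apply: cnatP => X g; rewrite rep_cnatE e -rep_cnatE. Qed.

Lemma rep_lift (A : kob P) (M N : cfun P) (t : cnat M N)
    (x : cnat (rep A) N) : pepi t -> exists y, cnat_comp t y = x.
Proof.
move=> /pepiP /(_ A (x A (kid A))) [y yE]; exists (yo_nat y).
by apply: rep_cnatP; rewrite cnat_compE yo_nat_kid.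
Qed.

(** [Q] has the generators of [N]; its relations are those of [N] together with the generators of
    [M], lifted to the cover of [N] by [w]. The biproduct [X] collects both in one representable. *)
Lemma coker_finitely_presented (M N Q : cfun P) (s : cnat M N) (t : cnat N Q) :
  is_additive P -> finitely_presented M -> finitely_presented N ->
  exact_at s t -> pepi t -> finitely_presented Q.
Proof.
move=> [_ biprod] [_ [AM [_ [pM [_ /pepiP pMe]]]]].
move=> [BN [AN [rN [pN [/exact_atP [pr rp] pNe]]]]] /exact_atP [ts st] te.
have [w wE] := rep_lift (cnat_comp s pM) pNe.
have {}wE A z : pN A (w A z) = s A (pM A z) by rewrite -!cnat_compE wE.
have [X [i1 [i2 [p1 [p2 [pi11 pi22 pi12 pi21 _]]]]]] := biprod BN AM.
exists X, AN, (cnat_comp rN (rep_nat p1) + cnat_comp w (rep_nat p2)).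
exists (cnat_comp t pN); split; last first.
  move/pepiP: te => te; move/pepiP: pNe => pNe; apply/pepiP => A z.
  have [y <-] := te A z; have [x <-] := pNe A y.
  by exists x; rewrite cnat_compE.
apply/exact_atP; split=> A x.
  rewrite add_lfunE !cnat_compE linearD /= pr add0r wE; exact: ts.
rewrite cnat_compE => /st [m]; have [y <-] := pMe A m; rewrite -wE => yE.
have [|z zE] := rp A (x - w A y); first by rewrite linearB /= yE subrr.
exists (kcmp i1 z + kcmp i2 y : kHom A X).
rewrite add_lfunE !cnat_compE !rep_postE !kcmpDr !kcmpA.
have -> : kcmp p1 i1 = kid BN := pi11.
have -> : kcmp p2 i2 = kid AM := pi22.
have -> : kcmp p1 i2 = 0 := pi12.
have -> : kcmp p2 i1 = 0 := pi21.
have z0 (B C D : P) (f : Hom B C) : kcmp (0 : Hom C D) f = 0 := cmp0m _ f.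
by rewrite !kcmp1m !z0 addr0 add0r zE subrK.
Qed.

End Functors.

(** * Finitely presented functors *)

Section FinitelyPresented.
Variables (k : fieldType) (P : klincat k).

Definition representable (M : modP P) : Prop :=
  exists A : P, isomorphic M (yoneda P A).

Local Notation pj := representable.
Local Notation mono := (t_mono pj).
Local Notation epi := (t_epi pj).
Local Notation exact := (t_exact pj).

Lemma representable_yoneda (A : P) : pj (yoneda P A).
Proof. by exists A, (idm _); apply: is_iso_idm. Qed.

Lemma yoneda_full (A B : P) (u : Hom (yoneda P A) (yoneda P B)) :
  exists f, fmap (yoneda P) f = u.
Proof.
exists (u A (kid A)); apply: rep_cnatP.
by rewrite /= rep_postE kcmpm1.
Qed.

Lemma yoneda_faithful (A B : P) (f g : Hom A B) :
  fmap (yoneda P) f = fmap (yoneda P) g -> f = g.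
Proof.
move=> /(congr1 (fun u : cnat (rep A) (rep B) => u A (kid A))) /=.
by rewrite !rep_postE !kcmpm1.
Qed.

Lemma hom_zeroP (L M N : modP P) (t : Hom M N) (s : Hom L M) :
  t ∘ s = 0 <-> forall A x, t A (s A x) = 0.
Proof.
split=> [ts A x|ts]; first by rewrite -cnat_compE [cnat_comp t s]ts lfunE.
by apply: cnatP => A x; rewrite [LHS]cnat_compE ts lfunE.
Qed.

Definition point (A : P) (M : modP P) (x : M A) : Hom (yoneda P A) M :=
  yo_nat x.

Lemma point_kid (A : P) (M : modP P) (x : M A) : point x A (kid A) = x.
Proof. exact: yo_nat_kid. Qed.

Lemma comp_point (A : P) (M N : modP P) (t : Hom M N) (x : M A) :
  t ∘ point x = point (t A x).
Proof. by apply: rep_cnatP; rewrite [LHS]cnat_compE !point_kid. Qed.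

Lemma point_inj (A : P) (M : modP P) (x y : M A) : point x = point y -> x = y.
Proof. by move=> e; rewrite -[x]point_kid -[y]point_kid e. Qed.

Lemma point0 (A : P) (M : modP P) : point (0 : M A) = 0.
Proof. by apply: rep_cnatP; rewrite point_kid lfunE. Qed.

Lemma hom_pointE (A : P) (M : modP P) (x : Hom (yoneda P A) M) :
  x = point (x A (kid A)).
Proof. by apply: rep_cnatP; rewrite point_kid. Qed.

Lemma representable_hom_point (T M : modP P) (x : Hom T M) : pj T ->
  exists (A : P) (y : M A) (p : Hom T (yoneda P A)) (q : Hom (yoneda P A) T),
  x = point y ∘ p /\ p ∘ q = idm _.
Proof.
move=> [A [p [q [qp pq]]]]; exists A, ((x ∘ q : cnat _ _) A (kid A)), p, q.
by rewrite -hom_pointE -cmpA qp cmpm1.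
Qed.

(** By Yoneda, maps from [yoneda P A] to [M] are the elements of [M A]; this and the next lemmas
    identify the tested notions with the pointwise ones. *)
Lemma t_monoE (L M : modP P) (s : Hom L M) : mono s <-> pmono s.
Proof.
split=> [sm|/pmonoP sm T x _].
  apply/pmonoP => A x sx; apply: point_inj; rewrite point0.
  by apply: sm (representable_yoneda A) _; rewrite comp_point sx point0.
by move=> /hom_zeroP sx; apply: cnatP => A z; rewrite lfunE /=; apply: sm.
Qed.

Lemma t_epiE (M N : modP P) (t : Hom M N) : epi t <-> pepi t.
Proof.
split=> [te|/pepiP te T x /(representable_hom_point x)].
  apply/pepiP => A y; have [z zE] := te _ (point y) (representable_yoneda A).
  exists (z A (kid A)); apply: point_inj.
  by rewrite -comp_point -hom_pointE.
move=> [A [y [p [q [-> _]]]]]; have [z zE] := te A y.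
by exists (point z ∘ p); rewrite cmpA comp_point zE.
Qed.

Lemma t_exactE (L M N : modP P) (s : Hom L M) (t : Hom M N) :
  exact s t <-> exact_at s t.
Proof.
split=> [[/hom_zeroP ts st]|/exact_atP [ts st]].
  apply/exact_atP; split=> // A y ty.
  have [|z zE] := st _ (point y) (representable_yoneda A).
    by rewrite comp_point ty point0.
  exists (z A (kid A)); apply: point_inj.
  by rewrite -comp_point -hom_pointE.
split; first exact/hom_zeroP.
move=> T x /(representable_hom_point x) [A [y [p [q [-> pq]]]]] ty.
have [|z zE] := st A y.
  apply: point_inj; rewrite point0 -comp_point.
  by rewrite -[_ ∘ _]cmpm1 -pq cmpA -(cmpA t) ty cmp0m.
by exists (point z ∘ p); rewrite cmpA comp_point zE.
Qed.

Lemma t_sesE (L M N : modP P) (s : Hom L M) (t : Hom M N) :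
  t_ses pj s t <-> pointwise_ses L M N s t.
Proof.
split=> -[h1 h2 h3].
  by split; [apply/t_monoE | apply/t_exactE | apply/t_epiE].
by split; [apply/t_monoE | apply/t_exactE | apply/t_epiE].
Qed.

Lemma mod_exact_t (F : functor (modP P) (modP P)) :
  mod_exact F -> t_exact_functor pj F.
Proof. by move=> FE L M N s t /t_sesE /FE /t_sesE. Qed.

Lemma representable_sep (M N : modP P) (t : Hom M N) :
  (forall T (x : Hom T M), pj T -> t ∘ x = 0) -> t = 0.
Proof.
move=> h; apply: cnatP => A x; rewrite lfunE /=; apply: point_inj.
by rewrite -comp_point point0 h //; apply: representable_yoneda.
Qed.

Lemma representable_iso (M N : modP P) : isomorphic M N -> pj N -> pj M.
Proof.
move=> [p [q [qp pq]]] [A [u [v [vu uv]]]]; exists A, (u ∘ p), (q ∘ v).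
by rewrite !cmpA -(cmpA q) vu cmpm1 qp -(cmpA u) pq cmpm1 uv.
Qed.

Lemma mod_ker_lift (L M N Z : modP P) (s : Hom L M) (t : Hom M N)
    (x : Hom Z M) : mono s -> exact s t -> t ∘ x = 0 -> exists y, s ∘ y = x.
Proof.
by move=> /t_monoE sm /t_exactE st /hom_zeroP; apply: cnat_lift.
Qed.

Lemma mod_coker_desc (L M N Z : modP P) (s : Hom L M) (t : Hom M N)
    (u : Hom M Z) : exact s t -> epi t -> u ∘ s = 0 -> exists v, v ∘ t = u.
Proof.
by move=> /t_exactE st /t_epiE te /hom_zeroP; apply: cnat_desc.
Qed.

Hypothesis P_additive : is_additive P.

Lemma mod_coker (M N : modP P) (s : Hom M N) :
  exists (Q : modP P) (q : Hom N Q), exact s q /\ epi q.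
Proof.
have fpQ := coker_finitely_presented P_additive (fpP M) (fpP N)
  (quot_proj_exact s) (quot_proj_epi s).
exists (Fpfun fpQ), (quot_proj s); split.
  by apply/t_exactE; apply: quot_proj_exact.
by apply/t_epiE; apply: quot_proj_epi.
Qed.

(** The pointwise cokernel is again finitely presented and completes [s] to a conflation. *)
Lemma mono_inflation (M N : modP P) (s : Hom M N) :
  mono s -> inflation pointwise_ses s.
Proof.
by move=> sm; have [Q [q [sq qe]]] := mod_coker s; exists Q, q; apply/t_sesE.
Qed.

Lemma representable_biprod (M N : modP P) : pj M -> pj N ->
  exists (X : modP P) (i1 : Hom M X) (i2 : Hom N X) (p1 : Hom X M)
    (p2 : Hom X N), pj X /\ is_biproduct i1 i2 p1 p2.
Proof.
move=> [A [u [u' [u'u uu']]]] [B [v [v' [v'v vv']]]].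
have [_ /(_ A B) [X [i1 [i2 [p1 [p2 [h1 h2 h3 h4 h5]]]]]]] := P_additive.
pose Y := fmap (yoneda P).
exists (yoneda P X), (Y _ _ i1 ∘ u), (Y _ _ i2 ∘ v), (u' ∘ Y _ _ p1),
  (v' ∘ Y _ _ p2); split; first exact: representable_yoneda.
have hY C D G (g : Hom D G) (f : Hom C D) :
  Y _ _ g ∘ Y _ _ f = Y _ _ (g ∘ f) by rewrite /Y fmapM.
split; rewrite !cmpA.
- by rewrite (cmp_rw u' (hY _ _ _ _ _)) h1 /Y fmap1 cmpm1.
- by rewrite (cmp_rw v' (hY _ _ _ _ _)) h2 /Y fmap1 cmpm1.
- by rewrite (cmp_rw u' (hY _ _ _ _ _)) h3 /Y fmap0 cmpm0 cmp0m.
- by rewrite (cmp_rw v' (hY _ _ _ _ _)) h4 /Y fmap0 cmpm0 cmp0m.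
by rewrite (cmp_rw _ uu') (cmp_rw _ vv') !cmpm1 !hY /Y -fmapD h5 fmap1.
Qed.

Lemma representable_split (M : modP P) (e : Hom M M) : split_idempotents P ->
  pj M -> e ∘ e = e -> exists (N : modP P) (r : Hom M N) (s : Hom N M),
  [/\ pj N, s ∘ r = e & r ∘ s = idm N].
Proof.
move=> P_split [A [u [v [vu uv]]]] ee.
have [f fE] := yoneda_full (u ∘ e ∘ v).
have [|B [r [s [sr rs]]]] := P_split A f.
  apply: yoneda_faithful; rewrite fmapM fE !cmpA.
  by rewrite (cmp_rw _ vu) cmpm1 (cmp_rw _ ee).
exists (yoneda P B), (fmap (yoneda P) r ∘ u), (v ∘ fmap (yoneda P) s).
split; first exact: representable_yoneda.
  rewrite !cmpA -(cmpA v) -fmapM sr fE !cmpA vu cmp1m.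
  by rewrite (cmp_rw _ vu) cmpm1.
by rewrite !cmpA (cmp_rw _ uv) cmpm1 -fmapM rs fmap1.
Qed.

(** * Injectivity of representables and existence of kernels *)

Hypothesis frob : is_frobenius (@pointwise_ses k P).
Hypothesis embeds : forall M : modP P, exists J (j : Hom M J), pj J /\ mono j.

(** Deflations are pointwise epimorphisms, so representables are projective, hence injective in a
    Frobenius category. *)
Lemma representable_injective (I : modP P) : pj I ->
  injective_ob pointwise_ses I.
Proof.
move=> pI; apply/(frob_projinj frob) => M N p f [L [i /t_sesE [_ _ pe]]].
exact: pe pI.
Qed.

(** Exactness makes the map [j] from the cokernel of [s] to [N] mono, so the factorization of [u]
    through that cokernel extends along [j]. *)
Lemma representable_inj (L M N I : modP P) (s : Hom L M) (t : Hom M N)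
    (u : Hom M I) :
  pj I -> exact s t -> u ∘ s = 0 -> exists v, v ∘ t = u.
Proof.
move=> pI [ts st] us; have [Q [q [sq qe]]] := mod_coker s.
have [u' u'E] := mod_coker_desc sq qe us.
have [j jE] := mod_coker_desc sq qe ts.
have jm : mono j.
  move=> T x pT jx; have [y yE] := qe _ x pT.
  have [|z zE] := st _ y pT; first by rewrite -jE -cmpA yE.
  by case: sq => qs _; rewrite -yE -zE cmpA qs cmp0m.
have [w wE] := representable_injective pI u' (mono_inflation jm).
by exists w; rewrite -jE cmpA wE.
Qed.

(* A projective [Q] is injective, hence a direct summand of a representable
   functor, and so lifts along every pointwise epimorphism, not only along
   deflations. *)
Lemma projective_section (Q B : modP P) (b : Hom B Q) :
  projective pointwise_ses Q -> epi b -> exists s, b ∘ s = idm Q.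
Proof.
move=> /(frob_projinj frob) Q_inj be; have [J [j [pJ jm]]] := embeds Q.
have [r rj] := Q_inj _ _ _ (idm Q) (mono_inflation jm).
by have [l bl] := be _ r pJ; exists (l ∘ j); rewrite cmpA bl.
Qed.

(* For a deflation [q : Q -> N] with [Q] projective, the pullback of [q] along
   [p] splits over [Q], and the kernel of [p] is its complement. *)
Lemma epi_kernel (M N : modP P) (p : Hom M N) : epi p ->
  exists (K : modP P) (i : Hom K M), t_kernel pj i p.
Proof.
move=> pe; have [Q [q [Qp dq]]] := frob_proj frob N.
have [B [p' [b [[sq pb] dp']]]] := ex_pullback (frob_exact frob) p dq.
have be : epi b.
  move=> T x pT; have [y yE] := pe _ (q ∘ x) pT.
  by have [|z [[bz _] _]] := pb _ x y; [rewrite yE | exists z].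
have [s bs] := projective_section Qp be.
(* ker p is isomorphic to ker b, hence to the cokernel of the section [s]. The map
   [p' ∘ (idm B - s ∘ b)] kills [s] and induces the inclusion [i]. *)
have [K [t [st te]]] := mod_coker s.
have [|i iE] := mod_coker_desc (u := p' ∘ (idm B - s ∘ b)) st te.
  by rewrite -cmpA cmpBl cmp1m -cmpA bs cmpm1 subrr cmpm0.
have pull0 T (x : Hom T B) : b ∘ x = 0 -> p' ∘ x = 0 -> x = 0.
  move=> bx px; have [|z [_ zu]] := pb _ (0 : Hom T Q) (0 : Hom T M).
    by rewrite !cmpm0.
  by rewrite -(zu x) // -(zu 0) // !cmpm0.
exists K, i; split.
  move=> T x pT ix; have [y yE] := te _ x pT.
  have yE' : y - s ∘ b ∘ y = 0.
    apply: pull0; first by rewrite cmpBr !cmpA bs cmp1m subrr.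
    by rewrite -[y in y - _]cmp1m -cmpBl cmpA -iE -cmpA yE.
  move/eqP: yE'; rewrite subr_eq0 => /eqP yE'.
  by case: st => ts _; rewrite -yE yE' !cmpA ts !cmp0m.
split.
  apply: (t_epiP representable_sep te).
  rewrite cmp0m -cmpA iE cmpA -sq -cmpA cmpBr cmpm1 cmpA bs cmp1m subrr.
  by rewrite cmpm0.
move=> T x pT px; have [|z [[bz p'z] _]] := pb _ (0 : Hom T Q) x.
  by rewrite cmpm0.
exists (t ∘ z); rewrite cmpA iE -cmpA cmpBl cmp1m -cmpA bz cmpm0 subr0.
exact: p'z.
Qed.

(** [epi_kernel] is applied twice: to the cokernel projection of [f], giving the image, and to the
    epimorphism from [M] onto that image. *)
Lemma mod_kernel (M N : modP P) (f : Hom M N) :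
  exists (K : modP P) (i : Hom K M), t_kernel pj i f.
Proof.
have [Q [q [[qf fq] qe]]] := mod_coker f.
have [I [j [jm [qj jq]]]] := epi_kernel qe.
have [p pE] := mod_ker_lift jm (conj qj jq) qf.
have [|K [i [im ip]]] := epi_kernel (p := p).
  move=> T x pT; have [|y yE] := fq _ (j ∘ x) pT.
    by rewrite cmpA qj cmp0m.
  by exists y; apply: (t_monoP representable_sep jm); rewrite cmpA pE.
exists K, i; split=> //; rewrite -pE; exact: t_exact_mono.
Qed.

End FinitelyPresented.

Theorem theorem8p0p3 (k : closedFieldType) (P : klincat k)
    (P_additive : is_additive P) (P_split : split_idempotents P)
    (modP_frobenius : is_frobenius (@pointwise_ses k P))
    (S : functor P P) (S_autoeq : is_autoequivalence S)
    (S' : functor (modP P) (modP P))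
    (S'_exact : mod_exact S') (S'_extends : extends S S')
    (X0 X1 X2 : functor (modP P) (modP P))
    (X0_exact : mod_exact X0) (X1_exact : mod_exact X1)
    (X2_exact : mod_exact X2)
    (X0_proj : values_in_proj X0) (X1_proj : values_in_proj X1)
    (X2_proj : values_in_proj X2)
    (d0 : nattrans (idF (modP P)) X0) (d1 : nattrans X0 X1)
    (d2 : nattrans X1 X2) (d3 : nattrans X2 S')
    (d_exact : exact_seq5 d0 d1 d2 d3) :
  has_triangulated_structure S.
Proof.
have d0_mono M : t_mono (@representable k P) (d0 M).
  by apply/t_monoE; case: (d_exact M).
have d01 M : t_exact (@representable k P) (d0 M) (d1 M).
  by apply/t_exactE; case: (d_exact M).
have d12 M : t_exact (@representable k P) (d1 M) (d2 M).
  by apply/t_exactE; case: (d_exact M).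
have d23 M : t_exact (@representable k P) (d2 M) (d3 M).
  by apply/t_exactE; case: (d_exact M).
have d3_epi M : t_epi (@representable k P) (d3 M).
  by apply/t_epiE; case: (d_exact M).
(* The first map of the given sequence embeds every functor in a representable one. *)
have embeds (M : modP P) :
    exists J (j : Hom M J), representable J /\ t_mono (@representable k P) j.
  by exists (X0 M), (d0 M); split; [apply: X0_proj | apply: d0_mono].
have [t it] := S'_extends.
pose t' A : Hom (yoneda P (S A)) (S' (yoneda P A)) := projT1 (cid (it A)).
have t't A : t' A ∘ t A = idm _ by case: (projT2 (cid (it A))).
have tt' A : t A ∘ t' A = idm _ by case: (projT2 (cid (it A))).
have S'_proj (M : modP P) : representable M -> representable (S' M).
  move=> [A [u iu]]; apply: (@representable_iso _ _ _ (S' (yoneda P A))).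
    by exists (fmap S' u); apply: fmap_iso.
  by exists (S A), (t A); apply: it.
apply: (@triangulated_transfer (modP P) (@representable k P) _ _ _ _ _ _
  S' X0 X1 X2 _ _ _ _ _ _ _ _ d0 d1 d2 d3 _ _ _ _ _ _ _ _ _
  P (yoneda P) S _ _ _ _ _ _ t t') => //.
- exact: representable_sep.
- exact: representable_inj.
- by move=> M N f _ _; apply: mod_kernel.
- exact: mod_ker_lift.
- exact: representable_biprod.
- by move=> M e; apply: representable_split.
- exact: mod_exact_t.
- exact: mod_exact_t.
- exact: mod_exact_t.
- exact: mod_exact_t.
- by move=> L M f; apply: (ntcP d0 f).
- by move=> L M f; apply: (ntcP d1 f).
- by move=> L M f; apply: (ntcP d2 f).
- by move=> L M f; apply: (ntcP d3 f).
- exact: representable_yoneda.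
- exact: yoneda_full.
- exact: yoneda_faithful.
by move=> M N f; apply: (ntcP t f).
Qed.
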